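(* Let $q$ be a prime power and let $k \geq 2$ be an integer. Then there exists a number $c_0(k,q)$ such that for all integers $n$ with $\max(k, n-k) \geq c_0(k,q)$, every Boolean degree $1$ function on the $k$-subspaces of an $n$-dimensional vector space $V$ over $\mathbb{F}_q$ is trivial, i.e. it is one of the following families of $k$-subspaces of $V$: (I) the empty family; (II) all $k$-subspaces containing a fixed $1$-dimensional subspace $P$; (III) all $k$-subspaces contained in a fixed hyperplane $H$ of $V$; (IV) the union of (II) and (III) for a $1$-space $P$ and a hyperplane $H$ with $P \not\subseteq H$; (V) the complement (in the set of all $k$-subspaces of $V$) of any family of type (I)–(IV).
   Context: Let $V$ be an $n$-dimensional vector space over the finite field $\mathbb{F}_q$; $1$-dimensional subspaces are called points. A family $Y$ of $k$-dimensional subspaces of $V$ is called a Boolean degree $1$ function on $J_q(n,k)$ (a Cameron–Liebler class) if there is a function $\mathrm{wt}$ from the set of points of $V$ to $\mathbb{R}$ such that for every $k$-subspace $S$ of $V$, $\sum_{P \subseteq S} \mathrm{wt}(P)$ (sum over points $P$ of $S$) equals $1$ if $S \in Y$ and $0$ if $S \notin Y$. (Equivalently, the indicator function of $Y$ is a real polynomial of degree at most $1$ in the point-indicator variables.) *)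

(* Defs.v *)
From HB Require Import structures.
From mathcomp Require Import all_boot all_order all_algebra.
From mathcomp Require Import reals.

Set Implicit Arguments.
Unset Strict Implicit.
Unset Printing Implicit Defensive.

Import GRing.Theory Num.Theory.
Local Open Scope ring_scope.

Definition prime_power (q : nat) : Prop :=
  exists p m : nat, [/\ prime p, (0 < m)%N & q = (p ^ m)%N].

(* A subspace is stored as a normalized square matrix over F, so there are    *)
(* finitely many when F is finite; the library does not provide the instance. *)
Section FiniteVspace.
Import VectorInternalTheory.
Variables (F : finFieldType) (V : vectType F).
HB.instance Definition _ := [Countable of {vspace V} by <:].
HB.instance Definition _ := [Finite of {vspace V} by <:].
End FiniteVspace.

Section Families.
Variables (F : finFieldType) (V : vectType F).
Implicit Types (P H S : {vspace V}) (Y Z : {set {vspace V}}).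

Definition subspaces (k : nat) : {set {vspace V}} := [set S | \dim S == k].

Definition is_point P : bool := \dim P == 1%N.

(* Not \dim H = (\dim {:V}).-1, which would admit H = 0 when V = 0. *)
Definition is_hyperplane H : bool := (\dim H).+1 == \dim {:V}.

(* Only the values of wt at points matter. *)
Definition boolean_degree1 (R : realType) (k : nat) Y : Prop :=
  Y \subset subspaces k /\
  exists wt : {vspace V} -> R,
    forall S, S \in subspaces k ->
      \sum_(P : {vspace V} | is_point P && (P <= S)%VS) wt P
        = if S \in Y then 1 else 0.

Definition star (k : nat) P : {set {vspace V}} :=
  [set S in subspaces k | (P <= S)%VS].

Definition costar (k : nat) H : {set {vspace V}} :=
  [set S in subspaces k | (S <= H)%VS].

Variant basic_family (k : nat) Y : Prop :=
| BasicEmpty of Y = set0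
| BasicStar P of is_point P & Y = star k P
| BasicCostar H of is_hyperplane H & Y = costar k H
| BasicUnion P H of is_point P & is_hyperplane H & ~~ (P <= H)%VS
    & Y = star k P :|: costar k H.

Definition trivial_family (k : nat) Y : Prop :=
  basic_family k Y \/
  exists2 Z, basic_family k Z & Y = subspaces k :\: Z.

End Families.

(* Main.v *)
Require Import Defs.
From mathcomp Require Import all_boot all_order all_algebra.
From mathcomp Require Import reals.
From mathcomp Require Import boolp ring lra zify.

(* Write q = #|F|, m = k - 1 and [j] = (q^j - 1)/(q - 1).  The point           *)
(* weights take boundedly many values (inside a (k+1)-space they are           *)
(* determined by the 0/1 values on its k-spaces), so the vector space Ramsey   *)
(* theorem, obtained from Hales-Jewett, applies to them.  For a line E it      *)
(* yields a k-space T disjoint from E, with a basis, such that w(e + l z)      *)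
(* depends only on (e, l) in E x F for all z in T whose leading coordinate is  *)
(* 1.  The weight is then constant on T, hence 0 or 1/[k]; replacing the       *)
(* family by its complement replaces w by 1/[k] - w, so assume it is 0.        *)
(* Summing over k-spaces spanned by e + l z and part of T forces w(e) to be in *)
(* {0, 1, q^-m, q^-m - 1}, and the k-spaces containing E show that after       *)
(* replacing q^-m by q^-1 the weights sum to 0 or 1 on E.  As E was arbitrary, *)
(* this reduces everything to lines: the points of weight 0 or 1 meet every    *)
(* line in 1 or q + 1 points, so they form the whole space or a hyperplane,    *)
(* and at most one point carries an exceptional weight 1 or q^-1 - 1.          *)

Set Implicit Arguments.
Unset Strict Implicit.
Unset Printing Implicit Defensive.
Import Order.TTheory GRing.Theory Num.Theory.
Local Open Scope ring_scope.

(** The outline above is carried by the following lemmas. [bounded_coloring] turns the weight into a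
    vector colouring whose number of colours depends only on q and k. From it, [exists_transversal]
    produces, for each line E separately, the k-dimensional space T of the outline. This is where n
    must be large; afterwards only n >= 3 matters. [transversal_dichotomy] and [line_structure]
    exploit the 0/1 condition on k-spaces spanned by vectors related to E and parts of T. The
    constant weight on T could be 0 for some lines and 1/[k] for others. [normal_weight_exclusive],
    a divisibility argument, forbids mixing, so by [regular_uniform] a single passage to the
    complement serves all lines. The problem on lines is solved by counting, modulo q, the points of
    non-integral weight ([line_cases], [integral_case], [fractional_case]). [trivial_of_regular]
    reads the family off the four possible weights: zero gives the empty family, the indicator of a
    point gives a star, q^-m off a hyperplane gives the complement of a costar, and the latter minus
    the indicator of a point off the hyperplane gives the complement of a union. *)

(** * The Hales-Jewett theorem *)

Section HalesJewett.
Local Open Scope nat_scope.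

(** Combinatorial lines are words with holes: [None] marks a moving coordinate. *)
Definition plug (x : nat) (l : seq (option nat)) : seq nat := map (odflt x) l.

Definition letters_below t (l : seq (option nat)) :=
  all (fun o => if o is Some a then a < t else true) l.

Definition mono_line t N (C : Type) (c : seq nat -> C) l :=
  [/\ size l = N, None \in l, letters_below t l &
      forall x y, x < t -> y < t -> c (plug x l) = c (plug y l)].

Lemma plug_const x (s : seq nat) : plug x (map Some s) = s.
Proof. by rewrite /plug -map_comp map_id. Qed.

Lemma letters_const t (s : seq nat) :
  letters_below t (map Some s) = all (fun a => a < t) s.
Proof. by rewrite /letters_below all_map. Qed.

Lemma letters_cat t l1 l2 :
  letters_below t (l1 ++ l2) = letters_below t l1 && letters_below t l2.
Proof. exact: all_cat. Qed.

Lemma plug_cat x l1 l2 : plug x (l1 ++ l2) = plug x l1 ++ plug x l2.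
Proof. exact: map_cat. Qed.

Lemma letters_plug t x l : x < t -> letters_below t l ->
  all (fun a => a < t) (plug x l).
Proof.
move=> xt /allP tl; rewrite all_map; apply/allP => -[a|] //= /tl //.
Qed.

Lemma letters_belowW t l : letters_below t l -> letters_below t.+1 l.
Proof. by apply: sub_all => -[a|] //; apply: ltnW. Qed.

(* Colour focusing: [ls] are lines through the common point [f] (the word at  *)
(* letter [t]) that are monochromatic off [f], in pairwise distinct colours.  *)
Definition focused t N (C : eqType) (c : seq nat -> C) f
    (ls : seq (seq (option nat))) :=
  [/\ size f = N, all (fun a => a < t.+1) f,
      (forall l, l \in ls ->
         [/\ size l = N, None \in l, letters_below t.+1 l, plug t l = f &
             forall x, x < t -> c (plug x l) = c (plug 0 l)]) &
      uniq [seq c (plug 0 l) | l <- ls]].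

(** The new line moves along [L] with the tail frozen at [f]; the old lines now move along [L] and
    their own tail together. If the new colour coincided with an old one, freezing the head at
    [plug 0 L] would extend the old line to its focus, giving a monochromatic line on all t + 1
    letters. *)
Lemma focused_step t N' N (C : eqType) (c : seq nat -> C) L f ls :
    0 < t -> size L = N' -> None \in L -> letters_below t L ->
    (forall x y u, x < t -> y < t -> size u = N -> all (fun a => a < t.+1) u ->
       c (plug x L ++ u) = c (plug y L ++ u)) ->
    focused t N (fun u => c (plug 0 L ++ u)) f ls ->
    (forall l, ~ mono_line t.+1 (N' + N) c l) ->
  focused t (N' + N) c (plug t L ++ f)
    ((L ++ map Some f) :: [seq L ++ l | l <- ls]).
Proof.
move=> t0 sL NL tL cL [sf af Hls uls] nomono.
have cl x l : l \in ls -> x < t -> c (plug x (L ++ l)) = c (plug 0 L ++ plug 0 l).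
  move=> /Hls[sl Nl tl fl cl] xt; rewrite plug_cat (cL x 0) ?size_map //.
    by rewrite cl.
  by apply: letters_plug tl; apply: ltnW.
split.
- by rewrite size_cat size_map sL sf.
- rewrite all_cat af andbT; apply: letters_plug => //; exact: letters_belowW.
- move=> l; rewrite inE => /orP[/eqP ->|/mapP[l' l'ls ->]].
    split.
    + by rewrite size_cat size_map sL sf.
    + by rewrite mem_cat NL.
    + by rewrite letters_cat letters_belowW // letters_const.
    + by rewrite plug_cat plug_const.
    + by move=> x xt; rewrite !plug_cat !plug_const; apply: cL.
  have [sl Nl tl fl cl'] := Hls _ l'ls; split.
  + by rewrite size_cat sL sl.
  + by rewrite mem_cat NL.
  + by rewrite letters_cat letters_belowW.
  + by rewrite plug_cat fl.
  + by move=> x xt; rewrite !cl.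
- rewrite /= -map_comp plug_cat plug_const.
  have -> : [seq ((fun l => c (plug 0 l)) \o (fun l => L ++ l)) l | l <- ls]
     = [seq c (plug 0 L ++ plug 0 l) | l <- ls].
    by apply/eq_in_map => l lls /=; rewrite cl.
  rewrite uls andbT; apply/mapP => -[l lls E].
  have [sl Nl tl fl cl'] := Hls _ lls.
  apply: (nomono (map Some (plug 0 L) ++ l)); split.
  + by rewrite size_cat !size_map sL sl.
  + by rewrite mem_cat Nl orbT.
  + rewrite letters_cat tl andbT letters_const.
    by apply: letters_plug => //; apply: letters_belowW.
  + have H x : x < t.+1 -> c (plug x (map Some (plug 0 L) ++ l)) = c (plug 0 L ++ f).
      rewrite ltnS leq_eqVlt plug_cat plug_const.
      by case/orP => [/eqP ->|xt]; rewrite ?fl // cl'.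
    by move=> x y xt yt; rewrite !H.
Qed.

(** Induction on the alphabet, then on the number of focused lines: more focused lines than colours
    is impossible. *)
Lemma hales_jewett t (C : finType) :
  exists N, forall c : seq nat -> C, exists l, mono_line t N c l.
Proof.
elim: t C => [|[_|t IH]] C.
- by exists 1 => c; exists [:: None].
- exists 1 => c; exists [:: None]; split => // x y.
  by rewrite !ltnS !leqn0 => /eqP -> /eqP ->.
have focus j : exists N, forall c : seq nat -> C,
    (exists l, mono_line t.+2 N c l) \/
    (exists f ls, size ls = j /\ focused t.+1 N c f ls).
  elim: j => [|j [N IHj]].
    by exists 0 => c; right; exists [::], [::].
  (* A head word is coloured by the whole colouring it induces on tails of length [N], so that along
     [L] every tail keeps its colour. *)
  have [N' HN'] := IH {ffun N.-tuple 'I_t.+2 -> C}.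
  exists (N' + N) => c.
  have [L [sL NL tL cL]] :=
    HN' (fun w => [ffun u : N.-tuple 'I_t.+2 => c (w ++ map val u)]).
  have cL' x y u : x < t.+1 -> y < t.+1 -> size u = N -> all (fun a => a < t.+2) u ->
      c (plug x L ++ u) = c (plug y L ++ u).
    move=> xt yt /eqP su /allP au.
    have su' : size (map (@inord t.+1) u) == N by rewrite size_map.
    have /ffunP /(_ (Tuple su')) := cL x y xt yt; rewrite !ffunE /=.
    have -> // : map val (map (@inord t.+1) u) = u.
    rewrite -map_comp map_id_in // => a /au ta /=; exact: inordK.
  have [[l [sl Nl tl cl]]|[f [ls [sls foc]]]] := IHj (fun u => c (plug 0 L ++ u)).
    left; exists (map Some (plug 0 L) ++ l); split.
    + by rewrite size_cat !size_map sL sl.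
    + by rewrite mem_cat Nl orbT.
    + rewrite letters_cat tl andbT letters_const.
      by apply: letters_plug => //; apply: letters_belowW.
    + move=> x y xt yt; rewrite !plug_cat !plug_const.
      exact: cl.
  have [[l lP]|nomono] := lem (exists l, mono_line t.+2 (N' + N) c l).
    by left; exists l.
  right; exists (plug t.+1 L ++ f), ((L ++ map Some f) :: [seq L ++ l | l <- ls]).
  split; first by rewrite /= size_map sls.
  by apply: focused_step => // l lP; apply: nomono; exists l.
have [N HN] := focus #|C|.+1; exists N => c.
have [//|[f [ls [sls [_ _ _ uls]]]]] := HN c.
have := max_card (mem [seq c (plug 0 l) | l <- ls]).
by rewrite (card_uniqP uls) size_map sls ltnn.
Qed.

End HalesJewett.

(** * Ramsey theorem for vector spaces *)

Section Free.
Variables (F : fieldType) (V : vectType F).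
Implicit Types (vs : seq V) (U W : {vspace V}).

Lemma memv_addl (x : V) U W : x \in U -> x \in (U + W)%VS.
Proof. exact: (subvP (addvSl U W)). Qed.

Lemma memv_addr (x : V) U W : x \in W -> x \in (U + W)%VS.
Proof. exact: (subvP (addvSr U W)). Qed.

Lemma free_dual n (X : n.-tuple V) (f : 'I_n -> {scalar V}) :
  (forall i j : 'I_n, f i X`_j = (i == j)%:R) -> free X.
Proof.
move=> fX; apply/freeP => a a0 i.
have := congr1 (f i) a0; rewrite linear0 linear_sum (bigD1 i) //= big1.
  by rewrite linearZ /= fX eqxx addr0 mulr1.
by move=> j ji; rewrite linearZ /= fX eq_sym (negPf ji) mulr0.
Qed.

Lemma free_subseq vs vs' : subseq vs' vs -> free vs -> free vs'.
Proof.
by move=> s fv; move/(subseq_uniqP (free_uniq fv)): s => ->; apply: filter_free.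
Qed.

Lemma seq_in_span (U : {vspace V}) vs : {subset vs <= U} -> (<<vs>> <= U)%VS.
Proof. by move=> sU; apply/span_subvP. Qed.

End Free.

(** Hales-Jewett over the alphabet F^D: a word of length [N] becomes a vector with N * D coordinates
    plus a fixed independent vector [e0]. A combinatorial line becomes a D-dimensional affine flat,
    directed by the sums [w j] of basis vectors over the moving positions; [e0] keeps it off the
    origin. *)
Lemma monochromatic_affine (q r D : nat) :
  exists N, forall (F : finFieldType) (V : vectType F) (U : {vspace V}),
    #|F| = q -> (N <= \dim U)%N -> forall chi : V -> 'I_r,
    exists u ws, [/\ size ws = D, free (u :: ws), {subset u :: ws <= U} &
      forall z, z \in <<ws>>%VS -> chi (u + z) = chi u].
Proof.
have [N HN] := hales_jewett (q ^ D) ('I_r : finType).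
exists (1 + N * D)%N => F V U qF dU chi.
have [X frX XU] : exists2 X : (1 + N * D).-tuple V,
    free X & forall i : 'I_(1 + N * D), X`_i \in U.
  have sX : size (take (1 + N * D) (vbasis U)) == (1 + N * D)%N.
    by rewrite size_takel // size_tuple.
  exists (Tuple sX) => [|i].
    by apply: free_subseq (take_subseq _ _) (basis_free (vbasisP U)).
  by apply: vbasis_mem; apply: mem_take (mem_nth _ _); rewrite (eqP sX).
pose e0 := X`_(@ord0 (N * D)).
have [k kI k0] : exists2 k : 'I_N -> 'I_D -> 'I_(1 + N * D),
    forall i j i' j', (k i j == k i' j') = (i == i') && (j == j') &
    forall i j, (k i j == ord0) = false.
  exists (fun i j => lift ord0 (mxvec_index i j)) => // i j i' j'.
  rewrite (inj_eq lift_inj) -xpair_eqE.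
  have [g gK _] := curry_mxvec_bij N D.
  have /inj_eq inj : injective (uncurry (@mxvec_index N D)).
    by apply: (can_inj (g := g)) => x; apply: gK.
  exact: (inj (i, j) (i', j')).
pose e i j := X`_(k i j).
pose dec a : 'rV[F]_D := nth 0 (enum {: 'rV[F]_D}) a.
pose enc (x : 'rV[F]_D) : nat := index x (enum {: 'rV[F]_D}).
have encK x : dec (enc x) = x by rewrite /dec nth_index // mem_enum.
have enc_lt x : (enc x < q ^ D)%N.
  by rewrite -qF -(mul1n D) -card_mx cardT index_mem mem_enum.
pose psi (s : seq nat) := e0 + \sum_(i < N) \sum_(j < D) dec (nth 0%N s i) 0 j *: e i j.
have [l [sl Nl _ cl]] := HN (fun s => chi (psi s)).
pose var := [pred i : 'I_N | nth None l i == None].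
pose w (j : 'I_D) := \sum_(i < N | var i) e i j.
pose u := psi (plug (enc 0) l).
have psiE x : psi (plug (enc x) l) = u + \sum_(j < D) x 0 j *: w j.
  rewrite /u /psi -addrA; congr (_ + _).
  rewrite (eq_bigr (fun j => \sum_(i < N) (if var i then x 0 j *: e i j else 0))); last first.
    by move=> j _; rewrite /w scaler_sumr big_mkcond.
  rewrite [X in _ + X]exchange_big -big_split /=; apply: eq_bigr => i _.
  rewrite -big_split /=; apply: eq_bigr => j _.
  rewrite !(nth_map None) ?sl //.
  case: (nth None l i) => [a|] /=; first by rewrite addr0.
  by rewrite !encK mxE scale0r add0r.
have [i0 vi0] : exists i0, var i0.
  have il : (index None l < N)%N by rewrite -sl index_mem.
  by exists (Ordinal il); rewrite /= nth_index.
have eU i j : e i j \in U by apply: XU.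
have cX := coord_free _ _ frX.
exists u, [tuple w j | j < D]; split; rewrite ?size_tuple //.
- rewrite free_cons; apply/andP; split.
    apply/negP => uw.
    have : coord X ord0 u = 0.
      apply/eqP; suff: (<<[tuple w j | j < D]>> <= lker (linfun (coord X ord0 : V -> F^o)))%VS.
        by move/subvP/(_ _ uw); rewrite memv_ker lfunE.
      apply: seq_in_span => _ /mapP[j _ ->]; rewrite memv_ker lfunE /=.
      by rewrite linear_sum big1 // => i _; rewrite /= /e cX k0.
    rewrite /u /psi linearD linear_sum big1 /=; last first.
      by move=> i _; rewrite linear_sum big1 // => j _; rewrite linearZ /= /e cX k0 mulr0.
    by rewrite /e0 cX addr0 eqxx; apply/eqP; rewrite oner_eq0.
  apply: (@free_dual _ _ _ _ (fun j => coord X (k i0 j))) => j j'.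
  rewrite -tnth_nth tnth_mktuple linear_sum (bigD1 i0) //= /e cX kI eqxx /=.
  rewrite big1 ?addr0 //; first by rewrite eq_sym.
  by move=> i /andP[_ ii0]; rewrite /e cX kI (negPf ii0).
- move=> v; rewrite inE => /orP[/eqP ->|/mapP[j _ ->]].
    by rewrite memvD ?XU // memv_suml // => i _; rewrite memv_suml // => j _; rewrite memvZ.
  by rewrite memv_suml.
- move=> z /coord_span ->.
  set x : 'rV[F]_D := \row_j coord [tuple w j | j < D] j z.
  rewrite (_ : \sum_i _ = \sum_(j < D) x 0 j *: w j); last first.
    by apply: eq_bigr => j _; rewrite mxE -tnth_nth tnth_mktuple.
  by rewrite -psiE; apply: cl.
Qed.

Section LeadingColor.
Variables (F : fieldType) (V : vectType F) (C : eqType) (chi : V -> C).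
Implicit Types (vs : seq V).

(* For a combination [z] of [vs] with leading coefficient 1, [chi z] depends   *)
(* only on the position of the leading term.                                   *)
Fixpoint lead_determined vs : Prop :=
  if vs is v :: vs' then
    (forall z, z \in <<vs'>>%VS -> chi (v + z) = chi v) /\ lead_determined vs'
  else True.

Fixpoint lead_mono c vs : Prop :=
  if vs is v :: vs' then
    (forall z, z \in <<vs'>>%VS -> chi (v + z) = c) /\ lead_mono c vs'
  else True.

Lemma lead_mono_subseq c vs vs' : subseq vs' vs -> lead_determined vs ->
  (forall v, v \in vs' -> chi v = c) -> lead_mono c vs'.
Proof.
elim: vs vs' => [|v vs IH] [|v' vs'] //=.
case: eqP => [->|_] s [dv dvs] vc.
  split; last by apply: IH => // x xs; apply: vc; rewrite inE xs orbT.
  move=> z zvs'; rewrite dv ?vc ?inE ?eqxx //.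
  by apply: (subvP (sub_span _)) z zvs' => x; apply: mem_subseq.
by have := IH (v' :: vs') s dvs vc.
Qed.

End LeadingColor.

(** Iterates [monochromatic_affine]: the base point of a flat becomes the next vector, and the
    search continues inside the direction space of that flat. *)
Lemma exists_lead_determined (q r M : nat) :
  exists N, forall (F : finFieldType) (V : vectType F) (U : {vspace V}),
    #|F| = q -> (N <= \dim U)%N -> forall chi : V -> 'I_r,
    exists vs, [/\ size vs = M, free vs, {subset vs <= U} &
      lead_determined chi vs].
Proof.
elim: M => [|M [D HD]].
  by exists 0%N => F V U _ _ chi; exists [::]; split; rewrite ?nil_free.
have [N HN] := monochromatic_affine q r D.
exists N => F V U qF NU chi.
have [u [ws [sws fr uwsU uwsc]]] := HN F V U qF NU chi.
move: fr; rewrite free_cons => /andP[uws fws].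
have wsU : (<<ws>> <= U)%VS.
  by apply: seq_in_span => x xs; apply: uwsU; rewrite inE xs orbT.
have dws : (D <= \dim <<ws>>)%N by rewrite (eqP fws) sws.
have [vs [svs fvs vsU ldvs]] := HD F V <<ws>>%VS qF dws chi.
have vsws := seq_in_span vsU.
exists (u :: vs); split => /=; rewrite ?svs //.
- by rewrite free_cons fvs andbT; apply: contra uws; apply: subvP.
- move=> x; rewrite inE => /orP[/eqP ->|/vsU xws]; first by rewrite uwsU ?mem_head.
  exact: (subvP wsU).
- by split=> // z /(subvP vsws); apply: uwsc.
Qed.

(** Pigeonhole on the colours of a lead-determined list; dropping vectors only shrinks the spans
    over which the colour must be constant. *)
Theorem vector_space_ramsey (q r d : nat) :
  exists N, forall (F : finFieldType) (V : vectType F) (U : {vspace V}),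
    #|F| = q -> (N <= \dim U)%N -> forall chi : V -> 'I_r,
    exists c vs, [/\ size vs = d, free vs, {subset vs <= U} &
      lead_mono chi c vs].
Proof.
have [N HN] := exists_lead_determined q r (r * d).+1.
exists N => F V U qF NU chi.
have [vs [svs fvs vsU ldvs]] := HN F V U qF NU chi.
have [c dc] : exists c, (d <= count (fun v => chi v == c) vs)%N.
  apply/existsP; apply: contraT => /existsPn nc.
  have : (\sum_(c : 'I_r) count (fun v => chi v == c) vs <= \sum_(c : 'I_r) d)%N.
    by apply: leq_sum => c _; apply: ltnW; rewrite ltnNge nc.
  rewrite sum_nat_const card_ord leqNgt => /negP[].
  rewrite -svs -sum1_size (partition_big chi predT) //=.
  by apply: eq_leq; apply: eq_bigr => c _; rewrite sum1_count.
pose vc := take d (filter (fun v => chi v == c) vs).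
have vcs : subseq vc vs.
  exact: subseq_trans (take_subseq _ _) (filter_subseq _ _).
exists c, vc; split.
- by rewrite size_takel // size_filter.
- exact: free_subseq fvs.
- by move=> x /(mem_subseq vcs)/vsU.
- apply: lead_mono_subseq vcs ldvs _ => v /mem_take.
  by rewrite mem_filter => /andP[/eqP].
Qed.

(** * Sums of weights over flats and subspaces *)

Section Points.
Variables (F : finFieldType) (V : vectType F).
Implicit Types (P U W : {vspace V}) (p v x y : V).

Lemma is_pointP P : reflect (exists2 p, p != 0 & P = <[p]>%VS) (is_point P).
Proof.
apply: (iffP eqP) => [dP|[p p0 ->]]; last by rewrite dim_vline p0.
have p0 : vpick P != 0 by rewrite vpick0 -dimv_eq0 dP.
exists (vpick P) => //; apply/eqP; rewrite eq_sym eqEdim dP dim_vline p0 leqnn.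
by rewrite -memvE memv_pick.
Qed.

Lemma point_line p : p != 0 -> is_point <[p]>%VS.
Proof. by move=> p0; apply/is_pointP; exists p. Qed.

Lemma point_le_line P p : is_point P -> (P <= <[p]>)%VS -> P = <[p]>%VS.
Proof.
move=> /eqP dP Pp; apply/eqP; rewrite eqEdim Pp dP dim_vline.
by case: (p != 0).
Qed.

Lemma memv_lineDP x a U :
  reflect (exists b u, u \in U /\ x = b *: a + u) (x \in <[a]> + U)%VS.
Proof.
apply: (iffP memv_addP) => [[_ /vlineP[b ->] [u uU ->]]|[b [u [uU ->]]]].
  by exists b, u.
by exists (b *: a); [rewrite memvZ ?memv_line | exists u].
Qed.

Lemma scale_memv (b : F) x U : b != 0 -> (b *: x \in U) = (x \in U).
Proof. by move=> b0; rewrite rpredZeq (negPf b0). Qed.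

Lemma line_scale (b : F) x : b != 0 -> (<[b *: x]> = <[x]>)%VS.
Proof.
move=> b0; apply/eqP; rewrite eqEsubv -!memvE memvZ ?memv_line //.
by apply/vlineP; exists b^-1; rewrite scalerA mulVf ?scale1r.
Qed.

End Points.

Lemma sumr_constT (R : nmodType) (T : finType) (x : R) : \sum_(i : T) x = x *+ #|T|.
Proof. by rewrite sumr_const. Qed.

Section Sums.
Variables (F : finFieldType) (V : vectType F) (R : zmodType).
Implicit Types (w : V -> R) (vs : seq V) (wt : {vspace V} -> R).

(* [flat_sum w a vs] sums [w] over the affine flat [a + <<vs>>], and          *)
(* [point_sum w vs] over the combinations of [vs] with leading coefficient 1, *)
(* which represent the points of [<<vs>>] when [vs] is free.                  *)
Fixpoint flat_sum w a vs : R :=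
  if vs is v :: vs' then \sum_(c : F) flat_sum w (a + c *: v) vs' else w a.

Fixpoint point_sum w vs : R :=
  if vs is v :: vs' then flat_sum w v vs' + point_sum w vs' else 0.

(** Each point of the larger space outside [<<vs>>] meets the affine flat in exactly one vector. *)
Lemma flat_sum_points wt a vs : free vs -> a \notin <<vs>>%VS ->
  \sum_(P : {vspace V} | [&& is_point P, (P <= <[a]> + <<vs>>)%VS
      & ~~ (P <= <<vs>>)%VS]) wt P
  = flat_sum (fun v => wt <[v]>%VS) a vs.
Proof.
elim: vs a => [|v vs IH] a.
  move=> _; rewrite span_nil memv0 => a0; rewrite addv0 /=.
  apply: big_pred1 => P; rewrite subv0 pred1E.
  apply/and3P/eqP => [[pP Pa _]|<-]; first exact/esym/point_le_line.
  by rewrite point_line // subvv -dimv_eq0 dim_vline a0.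
rewrite free_cons span_cons => /andP[vvs fvs] avs /=.
have avs' c : a + c *: v \notin <<vs>>%VS.
  apply: contra avs => H; rewrite -(addrK (c *: v) a) memvB //.
    exact: memv_addr.
  by rewrite memvZ // memv_addl ?memv_line.
rewrite [RHS](eq_bigr _ (fun c _ => esym (IH _ fvs (avs' c)))).
pose Q P := [&& is_point P, (P <= <[a]> + (<[v]> + <<vs>>))%VS
  & ~~ (P <= <[v]> + <<vs>>)%VS].
rewrite (exchange_big_dep Q) /=; last first.
  move=> c P _ /and3P[/is_pointP[p p0 ->]]; rewrite /Q point_line //= -!memvE.
  move=> /memv_lineDP[b [u [uvs pE]]] pvs.
  have b0 : b != 0 by apply: contraNneq pvs => b0; rewrite pE b0 scale0r add0r.
  apply/andP; split.
    rewrite pE memvD //; last by do 2![apply: memv_addr].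
    rewrite memvZ // memvD //; first by rewrite memv_addl ?memv_line.
    by rewrite memvZ // memv_addr // memv_addl ?memv_line.
  apply: contra avs => H; rewrite -(scale_memv _ _ b0).
  have -> : b *: a = p - (b * c) *: v - u.
    by rewrite pE scalerDr scalerA addrAC addrK addrK.
  by rewrite memvB ?(memv_addr _ uvs) // memvB // memvZ // memv_addl ?memv_line.
apply: eq_bigr => P /and3P[/is_pointP[p p0 ->]]; rewrite -!memvE.
move=> /memv_lineDP[b [_ [/memv_lineDP[g [u [uvs ->]]] pE]]] pvs.
have b0 : b != 0.
  by apply: contraNneq pvs => b0; rewrite pE b0 scale0r add0r; apply/memv_lineDP; exists g, u.
(* For p = b a + g v + u, rescaling the coefficient of a to 1 leaves g / b as the only slice
   containing the point. *)
rewrite (big_pred1 (g / b)) // => c; rewrite pred1E point_line //= -!memvE.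
have -> : p \notin <<vs>>%VS by apply: contra pvs; apply: memv_addr.
rewrite andbT; apply/memv_lineDP/eqP => [[b' [u' [u'vs pE']]]|<-]; last first.
  by exists b, u; split; rewrite // pE scalerDr scalerA mulrC divfK // addrA.
have bb : b = b'.
  apply/eqP; rewrite -subr_eq0; apply: contraNT avs => bb.
  rewrite -(scale_memv _ _ bb); apply/memv_lineDP; exists (b' * c - g), (u' - u).
  split; first by rewrite memvB.
  have ba : b *: a = b' *: (a + c *: v) + u' - (g *: v + u) by rewrite -pE' pE addrK.
  rewrite scalerBl ba scalerDr scalerA scalerBl opprD !addrA.
  by rewrite [LHS](ACl (1*6*2*4*3*5)) /= subrr add0r -addrA.
move: pE'; rewrite pE -bb scalerDr scalerA -addrA => /addrI E.
have : (g - b * c) *: v \in <<vs>>%VS.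
  have gv : g *: v = (b * c) *: v + u' - u by rewrite -E addrK.
  by rewrite scalerBl gv (ACl (1*4*2*3)) /= subrr add0r memvB.
rewrite rpredZeq (negPf vvs) orbF subr_eq0 => /eqP ->.
by rewrite mulrAC divff ?mul1r.
Qed.

Lemma point_sumE wt vs : free vs ->
  \sum_(P : {vspace V} | is_point P && (P <= <<vs>>)%VS) wt P
  = point_sum (fun v => wt <[v]>%VS) vs.
Proof.
elim: vs => [_|v vs IH].
  apply: big1 => P /andP[/eqP dP]; rewrite span_nil subv0 => /eqP P0.
  by move: dP; rewrite P0 dimv0.
rewrite free_cons => /andP[vvs fvs] /=.
rewrite -IH // -flat_sum_points // span_cons.
rewrite (bigID (fun P => ~~ (P <= <<vs>>)%VS)) /=; congr (_ + _).
  by apply: eq_bigl => P; rewrite andbA.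
apply: eq_bigl => P; rewrite negbK -andbA; congr (_ && _).
by apply: andb_idl => Pvs; apply: subv_trans Pvs (addvSr _ _).
Qed.

Lemma flat_sum_const w a c vs : (forall z, z \in <<vs>>%VS -> w (a + z) = c) ->
  flat_sum w a vs = c *+ #|F| ^ size vs.
Proof.
elim: vs a => [|v vs IH] a H /=.
  by rewrite -(addr0 a) H ?mem0v.
rewrite (eq_bigr (fun=> c *+ #|F| ^ size vs)) => [|d _].
  by rewrite sumr_constT -mulrnA expnS mulnC.
apply: IH => z zvs; rewrite -addrA H // span_cons memv_add //.
by rewrite memvZ ?memv_line.
Qed.

(* The q + 1 subspaces in the pencil between [<<vs>>] and [<<b :: a :: vs>>]   *)
(* cover the points of [<<vs>>] q + 1 times and all other points once.         *)
Lemma point_sum_pencil w a b vs :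
  point_sum w (a :: vs) + \sum_(c : F) point_sum w (b + c *: a :: vs)
  = point_sum w (b :: a :: vs) + point_sum w vs *+ #|F|.
Proof.
by rewrite /= big_split /= sumr_constT addrA; congr (_ + _); rewrite addrC addrA.
Qed.

End Sums.

(** * Point weights take boundedly many values *)

Section Extend.
Variables (F : fieldType) (V : vectType F).
Implicit Types (vs ws : seq V) (U : {vspace V}).

Lemma free_extend1 U vs : free vs -> {subset vs <= U} -> (size vs < \dim U)%N ->
  exists2 a, a \in U & free (a :: vs).
Proof.
move=> fvs vsU svs.
have /subvPn[a aU avs] : ~~ (U <= <<vs>>)%VS.
  by apply: contraL svs => /dimvS; rewrite (eqP fvs) -leqNgt.
by exists a => //; rewrite free_cons avs.
Qed.

Lemma free_extend U vs m : free vs -> {subset vs <= U} ->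
  (size vs + m <= \dim U)%N ->
  exists ws, [/\ size ws = m, free (ws ++ vs) & {subset ws <= U}].
Proof.
move=> fvs vsU; elim: m => [|m IH] sU; first by exists [::].
have [|ws [sws fws wsU]] := IH; first by rewrite (leq_trans _ sU) // leq_add2l.
have [||a aU fa] := @free_extend1 U (ws ++ vs) fws.
- by move=> x; rewrite mem_cat => /orP[/wsU|/vsU].
- by rewrite size_cat sws addnC -addnS.
exists (a :: ws); split; rewrite /= ?sws //.
by move=> x; rewrite inE => /orP[/eqP ->|/wsU].
Qed.

Lemma free_pencil a b vs (c : F) : free (b :: a :: vs) -> free (b + c *: a :: vs).
Proof.
rewrite !free_cons span_cons => /and3P[bavs _ ->]; rewrite andbT.
apply: contra bavs => H; rewrite -(addrK (c *: a) b) memvB //.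
  exact: memv_addr.
by rewrite memvZ // memv_addl ?memv_line.
Qed.

End Extend.

Definition zero_one (R : nzRingType) (x : R) : bool := (x == 0) || (x == 1).

Section BoundedValues.
Variables (F : finFieldType) (V : vectType F) (R : realType).
Variables (wt : {vspace V} -> R) (k : nat) (X : seq V).
Local Notation q := #|F|.
Local Notation w := (fun v => wt <[v]>%VS).
Hypothesis wt01 : forall vs, free vs -> size vs = k -> zero_one (point_sum w vs).
Hypotheses (frX : free X) (sX : size X = k.+1).
Let W := point_sum w X.

(* [q^i] times the weight of a subspace of codimension [i] in the (k+1)-space  *)
(* [<<X>>] is a bounded integer plus [pencil_coef i] times the total weight.   *)
Definition pencil_coef i : int := 1 - \sum_(j < i) (q ^ j)%:Z.

Lemma pencil_coefSS i :
  pencil_coef i.+2 = (q.+1)%:Z * pencil_coef i.+1 - q%:Z * pencil_coef i.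
Proof. by rewrite /pencil_coef !big_ord_recr /= expnS PoszM -addn1 PoszD; ring. Qed.

(** Induction on the codimension. The pencil identity expresses q times the weight of a subspace by
    the q + 1 subspaces one dimension above and the one two dimensions above. The bound survives
    because (q + 1) A + q <= (2q + 1) A for A = 2q + 1. *)
Lemma scaled_point_sum i vs : (i <= k.+1)%N ->
  free vs -> {subset vs <= <<X>>%VS} -> size vs = (k.+1 - i)%N ->
  exists2 z : int, `|z| <= ((2 * q + 1) ^ i)%:Z &
    q%:R ^+ i * point_sum w vs = z%:~R + (pencil_coef i)%:~R * W.
Proof.
have q0 : (0 < q)%N by apply/card_gt0P; exists 0.
elim/ltn_ind: i vs => -[|[|i]] IH vs ik fvs vsX svs.
- exists 0; rewrite // /pencil_coef big_ord0 subr0 expr0 mul1r mul1r add0r.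
  rewrite /W -!point_sumE //; apply: eq_bigl => P; congr (_ && (_ <= _)%VS).
  apply/eqP; rewrite eqEdim seq_in_span //.
  by rewrite (eqP frX) (eqP fvs) sX svs subn0 leqnn.
- have := wt01 fvs; rewrite svs subSS subn0 => /(_ erefl)/orP[]/eqP ->.
    exists 0 => //; rewrite /pencil_coef big_ord1 /=; ring.
  exists q%:Z; first lia.
  by rewrite /pencil_coef big_ord1 expn0 subrr mul0r addr0 expr1 mulr1.
have sU : (size vs + 2 <= \dim <<X>>%VS)%N by rewrite (eqP frX) sX svs; lia.
have [ws [sws fba baX]] := free_extend fvs vsX sU.
case: ws sws fba baX => [|b [|a [|? ?]]] //= _ fba baX.
have [aX bX] : a \in <<X>>%VS /\ b \in <<X>>%VS by split; apply: baX; rewrite !inE eqxx ?orbT.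
have fa : free (a :: vs) by move: fba; rewrite free_cons => /andP[_].
have sub1 x : x \in <<X>>%VS -> {subset x :: vs <= <<X>>%VS}.
  by move=> xX y; rewrite inE => /orP[/eqP ->|/vsX].
have [||||z0 z0b z0E] := IH i (leqnSn _) (b :: a :: vs); rewrite //=; try lia.
  by move=> y; rewrite inE => /orP[/eqP ->|/sub1->].
have IH1 x : x \in <<X>>%VS -> free (x :: vs) ->
  exists2 z : int, `|z| <= ((2 * q + 1) ^ i.+1)%:Z &
    q%:R ^+ i.+1 * point_sum w (x :: vs) = z%:~R + (pencil_coef i.+1)%:~R * W.
  by move=> xX fx; apply: IH; rewrite ?ltnSn //=; [lia|apply: sub1|lia].
have [z1 z1b z1E] := IH1 a aX fa.
have /fin_all_exists2[zf zfb zfE] (c : F) := IH1 (b + c *: a)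
  (memvD bX (memvZ c aX)) (free_pencil c fba).
exists (z1 + \sum_c zf c - q%:Z * z0).
  have : `|\sum_c zf c| <= q%:Z * ((2 * q + 1) ^ i.+1)%:Z.
    apply: le_trans (ler_norm_sum _ _ _) _; apply: le_trans (ler_sum _ (fun c _ => zfb c)) _.
    by rewrite sumr_constT -mulr_natl natz.
  have le : ((2 * q + 1) ^ i <= (2 * q + 1) ^ i.+1)%N by rewrite leq_pexp2l // addn1.
  have : q%:Z * `|z0| <= q%:Z * ((2 * q + 1) ^ i.+1)%:Z.
    by rewrite ler_wpM2l //; apply: le_trans z0b _.
  move: z1b; rewrite [((2 * q + 1) ^ i.+2)%N]expnS.
  move: (\sum_c _) ((_ ^ i.+1)%N) => s e; nia.
have E : q%:R ^+ i.+2 * point_sum w vs =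
    q%:R ^+ i.+1 * point_sum w (a :: vs)
    + \sum_c q%:R ^+ i.+1 * point_sum w (b + c *: a :: vs)
    - q%:R * (q%:R ^+ i * point_sum w (b :: a :: vs)).
  by rewrite -mulr_sumr -mulrDr point_sum_pencil -mulr_natl !exprS; ring.
rewrite E z1E z0E (eq_bigr _ (fun c _ => zfE c)) big_split /= sumr_constT.
rewrite pencil_coefSS; move: (pencil_coef i) (pencil_coef i.+1) => B0 B1.
rewrite !(rmorphB, rmorphD, rmorphM) /= rmorph_sum /= -mulr_natl intS rmorphD /=.
by ring.
Qed.

End BoundedValues.

(** The term q^0 cancels the 1, and at least one further power of q remains, so the coefficient is
    negative. This permits solving for the total weight. *)
Lemma pencil_coef_neq0 (F : finFieldType) k : (0 < k)%N -> pencil_coef F k.+1 != 0.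
Proof.
case: k => // k _; rewrite /pencil_coef big_ord_recr big_ord_recl /= expn0.
have q0 : (0 < #|F| ^ k.+1)%N by rewrite expn_gt0; apply/orP; left; apply/card_gt0P; exists (0:F).
have : 0 <= \sum_(i < k) (#|F| ^ bump 0 i)%:Z by apply: sumr_ge0.
by move: q0; move: (\sum_(i < k) _) ((_ ^ k.+1)%N) => s e; lia.
Qed.

(* Combining the cases of a point and of the zero subspace of [scaled_point_sum] *)
(* eliminates the unknown total weight of the (k+1)-space.                       *)
Lemma bounded_coloring (q k : nat) : (0 < k)%N -> exists r, forall (R : realType)
    (F : finFieldType) (V : vectType F) (wt : {vspace V} -> R),
  #|F| = q -> (k < \dim {:V})%N ->
  (forall vs, free vs -> size vs = k ->
     zero_one (point_sum (fun v => wt <[v]>%VS) vs)) ->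
  exists col : V -> 'I_r, forall x y, x != 0 -> y != 0 -> col x = col y ->
    wt <[x]>%VS = wt <[y]>%VS.
Proof.
move=> k0; pose Q j := (\sum_(i < j) q ^ i)%N.
pose K := ((Q k.+1).+1 * (2 * q + 1) ^ k + (Q k).+1 * (2 * q + 1) ^ k.+1)%N.
exists (2 * K).+1 => R F V wt qF kV wt01.
have q0 : (0 < q)%N by rewrite -qF; apply/card_gt0P; exists 0.
(* A common denominator for all point weights; [K] bounds the numerators. *)
pose D : int := pencil_coef F k.+1 * (q ^ k)%N.
have D0 : D != 0 by rewrite mulf_neq0 ?pencil_coef_neq0 // -lt0n expn_gt0 q0.
have absB j : `|pencil_coef F j| <= (Q j).+1%:Z.
  rewrite /pencil_coef (_ : \sum_(i < j) _ = (Q j)%:Z); first lia.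
  by rewrite /Q -natz natr_sum; apply: eq_bigr => i _; rewrite qF natz.
have valz x : x != 0 -> exists2 z : int, `|z| <= K%:Z & D%:~R * wt <[x]>%VS = z%:~R.
  move=> x0; have fx : free [:: x] by rewrite seq1_free.
  have [||ws [sws frX _]] := @free_extend _ _ fullv [:: x] k fx.
  - by move=> y _; rewrite memvf.
  - by rewrite add1n.
  have sX : size (ws ++ [:: x]) = k.+1 by rewrite size_cat sws addn1.
  have xX : x \in <<ws ++ [:: x]>>%VS by rewrite memv_span // mem_cat mem_head orbT.
  have [||||z1 z1b z1E] := scaled_point_sum wt01 frX sX (i := k) (vs := [:: x]); rewrite //.
  - by move=> y; rewrite inE => /eqP ->.
  - by rewrite /= subSnn.
  have [||||z0 z0b z0E] := scaled_point_sum wt01 frX sX (i := k.+1) (vs := [::]); rewrite ?nil_free ?subnn //.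
  exists (pencil_coef F k.+1 * z1 - pencil_coef F k * z0).
    apply: le_trans (ler_normB _ _) _; rewrite !normrM /K PoszD !PoszM -qF.
    by rewrite lerD // ler_pM // qF absB.
  move: z1E z0E; rewrite qF /= mulr0 addr0 /D.
  move: (pencil_coef F k) (pencil_coef F k.+1) => B A z1E z0E.
  rewrite !(rmorphB, rmorphM) /=.
  have -> : (q ^ k)%N%:~R = q%:R ^+ k :> R by rewrite -natrX pmulrn.
  rewrite -mulrA z1E; move: z0E; set W := point_sum _ _ => z0E.
  have -> : z0%:~R = - A%:~R * W :> R.
    by rewrite mulNr; apply/eqP; rewrite -addr_eq0 -z0E.
  by ring.
(* Shifting the numerators by [K] places them between 0 and 2K, so [inord] never falls back to its
   default on nonzero vectors. *)
exists (fun x => inord (absz (Num.floor (D%:~R * wt <[x]>%VS : R) + K%:Z)%R)) => x y x0 y0.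
have [a ab aE] := valz x x0; have [b bb bE] := valz y y0.
rewrite aE bE !intrKfloor => /(congr1 val); rewrite /= !inordK; try lia.
move=> ab'; have {ab'} ab' : a = b by lia.
by apply: (@mulfI _ (D%:~R : R)); rewrite ?intr_eq0 // aE bE ab'.
Qed.

(** * Weights around a line *)

(** The number of points of an n-dimensional space over the field with q elements. *)
Definition gauss (q n : nat) : nat := \sum_(i < n) q ^ i.

Lemma gaussS q n : gauss q n.+1 = (gauss q n + q ^ n)%N.
Proof. by rewrite /gauss big_ord_recr. Qed.

Lemma gaussE (R : comNzRingType) q n : (gauss q n)%:R * (q%:R - 1) = q%:R ^+ n - 1 :> R.
Proof.
elim: n => [|n IH]; first by rewrite /gauss big_ord0 mul0r subrr.
by rewrite gaussS natrD mulrDl IH natrX exprS; ring.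
Qed.

Lemma gauss_gt0 q n : (0 < n)%N -> (0 < gauss q n)%N.
Proof. by case: n => // n _; rewrite /gauss big_ord_recl expn0. Qed.

Section LeadMono.
Variables (F : fieldType) (V : vectType F).
Implicit Types (vs : seq V).

Lemma lead_mono_catl (C : eqType) (chi : V -> C) c vs ts :
  lead_mono chi c (vs ++ ts) -> lead_mono chi c vs.
Proof.
elim: vs => //= v vs IH [H /IH]; split=> // z zvs; apply: H.
by rewrite span_cat memv_addl.
Qed.

Lemma lead_mono_catr (C : eqType) (chi : V -> C) c vs ts :
  lead_mono chi c (vs ++ ts) -> lead_mono chi c ts.
Proof. by elim: vs => //= v vs IH [_ /IH]. Qed.

Lemma lead_mono_impl (C C' : eqType) (chi : V -> C) (chi' : V -> C') c c' vs :
  free vs -> lead_mono chi c vs ->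
  (forall z, z \in <<vs>>%VS -> z != 0 -> chi z = c -> chi' z = c') ->
  lead_mono chi' c' vs.
Proof.
elim: vs => //= v vs IH; rewrite free_cons => /andP[vvs fvs] [H lm] I.
split; last by apply: IH => // z zvs; apply: I; rewrite span_cons memv_addr.
move=> z zvs; apply: I (H _ zvs); first by rewrite span_cons memv_add ?memv_line.
by apply: contraNneq vvs => /eqP; rewrite addr_eq0 => /eqP ->; rewrite memvN.
Qed.

End LeadMono.

Section Local.
Variables (F : finFieldType) (V : vectType F) (R : realType).
Variables (w : V -> R) (m : nat).
Local Notation q := #|F|.
Hypothesis m_gt0 : (0 < m)%N.
Hypothesis w01 : forall vs, free vs -> size vs = m.+1 -> zero_one (point_sum w vs).
Implicit Types (vs ts : seq V) (c : F -> R) (e : V).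

Lemma point_sum_lead (c0 : R) vs : lead_mono w c0 vs -> point_sum w vs = (gauss q (size vs))%:R * c0.
Proof.
elim: vs => [|v vs IH] /=; first by rewrite /gauss big_ord0 mul0r.
move=> [H /IH ->]; rewrite (flat_sum_const H) gaussS natrD mulrDl.
by rewrite addrC -[c0 *+ _]mulr_natl.
Qed.

(** For free [vs], every nonzero vector of the span is uniquely [l *: z] with [l] nonzero and [z] of
    leading coefficient 1. Thus on the flat through [e], away from [e], the weight depends only on
    the leading coefficient. *)
Definition transversal_mono c e vs :=
  forall l, l != 0 -> lead_mono (fun z => w (e + l *: z)) (c l) vs.

Definition transversal_total c : R := \sum_(l | l != 0) c l.

Lemma flat_sum_layer c e vs v b l : transversal_mono c e (v :: vs) -> l != 0 ->
  forall ts, subseq ts vs -> b \in <<vs>>%VS ->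
  flat_sum w (e + b + l *: v) ts = c l *+ q ^ size ts.
Proof.
move=> tm l0 ts sts bvs; apply: flat_sum_const => z zts.
have [H _] := tm l l0.
have -> : e + b + l *: v + z = e + l *: (v + l^-1 *: (b + z)).
  by rewrite scalerDr scalerA divff // scale1r !addrA (addrAC e b).
apply: H; rewrite memvZ // memvD //.
by apply: subvP z zts; apply: sub_span => x; apply: mem_subseq.
Qed.

(** As [ts] comes after [vs], adding [b] does not change the leading term of a nonzero combination
    of [vs]. Each nonzero [l] is the leading coefficient of as many combinations as the span of [vs]
    has points. *)
Lemma flat_sum_transversal c e vs ts b :
  transversal_mono c e (vs ++ ts) -> b \in <<ts>>%VS ->
  flat_sum w (e + b) vs = w (e + b) + (gauss q (size vs))%:R * transversal_total c.
Proof.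
move=> + bts; elim: vs => [|v vs IH] tm.
  by rewrite /gauss big_ord0 mul0r addr0.
rewrite /= (bigD1 0) //= scale0r addr0 IH; last by move=> l l0; have [_] := tm l l0.
rewrite -addrA; congr (_ + _).
rewrite (eq_bigr (fun l => c l *+ q ^ size vs)); last first.
  move=> l l0; apply: flat_sum_layer tm l0 _ _ _; first exact: prefix_subseq.
  by rewrite span_cat memv_addr.
by rewrite sumrMnl gaussS natrD mulrDl -[X in _ + X = _]mulr_natl.
Qed.

(** Two kinds of k-spaces are tested: those spanned by [e + l *: v] and all of [vs] but its first
    vector [v], and those spanned by [e + b] and all of [vs] but its last vector [vk], with [b] a
    multiple of [vk]. *)
Lemma transversal_dichotomy c e vs : free (e :: vs) -> size vs = m.+1 ->
    lead_mono w 0 vs -> transversal_mono c e vs ->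
  (zero_one (w e) /\ transversal_total c = 0) \/
  (zero_one (q%:R ^- m - w e) /\ transversal_total c = (q%:R - 1) * q%:R ^- m).
Proof.
move=> fevs svs lm tm.
have q1 : 1 < q%:R :> R by rewrite ltr1n card_finNzRing_gt1.
have q0 : 0 < q%:R :> R by apply: lt_trans q1.
set G := transversal_total c; set t := q%:R ^- m.
have t0 : 0 < t by rewrite invr_gt0 exprn_gt0.
have gt : (gauss q m)%:R * ((q%:R - 1) * t) = 1 - t :> R.
  by rewrite mulrA gaussE mulrBl mul1r divff ?expf_neq0 ?gt_eqF.
have g0 : 0 < (gauss q m)%:R :> R by rewrite ltr0n gauss_gt0.
have evs : e \notin <<vs>>%VS by move: fevs; rewrite free_cons => /andP[].
have fvs : free vs by move: fevs; rewrite free_cons => /andP[].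
have sumt : \sum_(l : F | l != 0) t = (q%:R - 1) * t.
  have := sumr_constT F t; rewrite (bigD1 0) //= mulrBl mul1r mulr_natl => <-.
  by rewrite addrAC subrr add0r.
(* The first kind consists of weight-zero points and q^m points of weight [c l]. *)
have layer l : l != 0 -> c l = 0 \/ c l = t.
  move=> l0; case: vs svs lm tm fvs evs {fevs} => // v vs [svs] lm tm fvs evs.
  have fr : free (e + 0 + l *: v :: vs).
    rewrite addr0; apply: free_pencil; rewrite free_cons fvs andbT.
    by move: evs.
  have := w01 fr; rewrite /= svs => /(_ erefl).
  rewrite (flat_sum_layer tm l0) ?mem0v // (point_sum_lead (proj2 lm)) mulr0 addr0.
  rewrite svs -mulr_natl natrX => /orP[]/eqP E.
    by left; apply/eqP; move/eqP: E; rewrite mulf_eq0 expf_eq0 (gt_eqF q0) andbF.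
  by right; rewrite -[LHS](mulKf (expf_neq0 m (lt0r_neq0 q0))) E mulr1.
have [vs1 [vk vsE]] : exists vs1 vk, vs = vs1 ++ [:: vk].
  case/lastP: vs svs {fevs lm tm layer evs fvs} => // vs1 vk _; exists vs1, vk.
  by rewrite cats1.
move: lm tm fvs evs svs; rewrite vsE size_cat addn1 => lm tm fvs evs [svs].
have sum1 b : b \in <<[:: vk]>>%VS -> zero_one (w (e + b) + (gauss q m)%:R * G).
  move=> bvk; have fr : free (e + b :: vs1).
    rewrite free_cons (catl_free fvs) andbT; apply: contra evs => H.
    by rewrite -(addrK b e) memvB // span_cat ?(memv_addl _ H) ?memv_addr.
  have := w01 fr; rewrite /= svs => /(_ erefl).
  by rewrite (flat_sum_transversal tm bvk) (point_sum_lead (lead_mono_catl lm)) mulr0 addr0 svs.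
have we := sum1 0 (mem0v _); rewrite addr0 in we.
have cl l : l != 0 -> zero_one (c l + (gauss q m)%:R * G).
  move=> l0; have := sum1 (l *: vk); rewrite memvZ ?memv_span1 // => /(_ isT).
  have [+ _] := lead_mono_catr (tm l l0) => /(_ 0 (mem0v _)).
  by rewrite addr0 => ->.
(* A vanishing [c l] makes [m] G equal to 0 or 1, while [m] G <= 1 - t < 1; hence G = 0. Otherwise
   every [c l] is t and [m] G = 1 - t. *)
have [[l l0 cl0]|call] := pselect (exists2 l, l != 0 & c l = 0); [left|right].
  have G0 : 0 <= G.
    by apply: sumr_ge0 => i /layer[]->//; exact: ltW.
  have Gt : G <= (q%:R - 1) * t.
    by rewrite -sumt; apply: ler_sum => i /layer[]->//; exact: ltW.
  have : zero_one ((gauss q m)%:R * G) by have := cl l l0; rewrite cl0 add0r.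
  case/orP => [|/eqP E].
    rewrite mulf_eq0 (gt_eqF g0) /= => /eqP GE; split => //.
    by move: we; rewrite GE mulr0 addr0.
  by have := ler_wpM2l (ltW g0) Gt; rewrite gt E; lra.
have GE : G = (q%:R - 1) * t.
  by rewrite -sumt; apply: eq_bigr => l l0; have [cl0|//] := layer l l0; case: call; exists l.
split => //; move: we; rewrite GE gt => /orP[]/eqP E; apply/orP; [right|left]; apply/eqP; lra.
Qed.

(* Normal weights are 0, 1, q^-m and q^-m - 1; reducing them replaces q^-m by   *)
(* q^-1, so that sums over k-spaces through a line become sums over the line.   *)
Definition reduced_weight e : R :=
  if zero_one (w e) then w e else w e + (q%:R^-1 - q%:R ^- m).

Definition normal_weight e : bool := zero_one (w e) || zero_one (q%:R ^- m - w e).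

(** In the k-space spanned by the line and m - 1 vectors of T, each point of the line contributes
    its own weight plus that of its flat. In the second case of the dichotomy the flat adds (q^(m-1)
    - 1) q^-m, exactly the correction made by [reduced_weight]. *)
Lemma line_structure x y vs : free ([:: y; x] ++ vs) -> size vs = m.+1 ->
    lead_mono w 0 vs ->
    (forall e, e \in <<[:: y; x]>>%VS -> exists c, transversal_mono c e vs) ->
  (forall e, e \in <<[:: y; x]>>%VS -> e != 0 -> normal_weight e) /\
  zero_one (reduced_weight x + \sum_l reduced_weight (y + l *: x)).
Proof.
move=> fr svs lm tm.
have q1 : 1 < q%:R :> R by rewrite ltr1n card_finNzRing_gt1.
have q0 : 0 < q%:R :> R by apply: lt_trans q1.
have [fxy fvs /directv_addP cap] : [/\ free [:: y; x], free vs &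
    directv (<<[:: y; x]>> + <<vs>>)] by apply/and3P; rewrite -cat_free.
have fe e : e \in <<[:: y; x]>>%VS -> e != 0 -> free (e :: vs).
  move=> exy e0; rewrite free_cons fvs andbT; apply: contra e0 => evs.
  by rewrite -memv0 -cap memv_cap exy.
split=> [e exy e0|].
  have [c tmc] := tm e exy.
  by have [[we _]|[we _]] := transversal_dichotomy (fe e exy e0) svs lm tmc;
    rewrite /normal_weight we ?orbT.
pose vs0 := take m.-1 vs; pose ts := drop m.-1 vs.
have vsE : vs = vs0 ++ ts by rewrite cat_take_drop.
have svs0 : size vs0 = m.-1 by rewrite size_takel // svs; lia.
have flatE e : e \in <<[:: y; x]>>%VS -> e != 0 -> flat_sum w e vs0 = reduced_weight e.
  move=> exy e0; have [c tmc] := tm e exy.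
  have := tmc; rewrite vsE => /(flat_sum_transversal)/(_ (mem0v _)).
  rewrite addr0 svs0 => ->.
  have := transversal_dichotomy (fe e exy e0) svs lm tmc.
  rewrite /reduced_weight => -[[-> ->]|[wt ->]]; first by rewrite mulr0 addr0.
  have t0 : 0 < q%:R ^- m :> R by rewrite invr_gt0 exprn_gt0.
  have t1 : q%:R ^- m < 1 :> R by rewrite invf_lt1 ?exprn_gt0 // exprn_egt1 // -lt0n.
  rewrite ifF; last first.
    by apply/negP => /orP[]/eqP wE; move: wt; rewrite wE => /orP[]/eqP; lra.
  rewrite mulrA gaussE -[in X in _ ^- X](prednK m_gt0) exprS; congr (_ + _).
  have qm0 : q%:R ^+ m.-1 != 0 :> R by rewrite expf_neq0 // gt_eqF.
  by field; rewrite qm0 gt_eqF.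
have xxy : x \in <<[:: y; x]>>%VS by rewrite memv_span // !inE eqxx orbT.
have lxy l : y + l *: x \in <<[:: y; x]>>%VS.
  by rewrite memvD ?memvZ // memv_span // inE eqxx.
have x0 : x != 0 by apply: (free_not0 fxy); rewrite !inE eqxx orbT.
have l0 l : y + l *: x != 0.
  have := free_pencil l fxy; rewrite free_cons span_nil memv0.
  by case/andP.
have fr0 : free (y :: x :: vs0).
  by apply: (@catl_free _ _ ts); rewrite /= -vsE.
have := w01 fr0; rewrite /= svs0 prednK // => /(_ erefl).
rewrite flatE // (eq_bigr _ (fun l _ => flatE _ (lxy l) (l0 l))).
have lm0 : lead_mono w 0 vs0 by move: lm; rewrite vsE => /lead_mono_catl.
by rewrite (point_sum_lead lm0) mulr0 addr0 addrC.
Qed.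

End Local.

Lemma exists_transversal (q m : nat) : exists N, forall (R : realType)
    (F : finFieldType) (V : vectType F) (wt : {vspace V} -> R),
  let w := fun v => wt <[v]>%VS in
  #|F| = q -> (N <= \dim {:V})%N ->
  (forall vs, free vs -> size vs = m.+1 -> zero_one (point_sum w vs)) ->
  forall x y, free [:: y; x] -> exists (c0 : R) vs,
    [/\ free ([:: y; x] ++ vs), size vs = m.+1, lead_mono w c0 vs &
        forall e, e \in <<[:: y; x]>>%VS -> exists c, transversal_mono w c e vs].
Proof.
have [r Hr] := bounded_coloring q (ltn0Sn m).
have [N HN] := vector_space_ramsey q (r ^ (q * q * q)) m.+1.
exists (N + m + 3)%N => R F V wt w qF dV w01 x y fxy.
have [|col colE] := Hr R F V wt qF _ w01; first lia.
pose A := <<[:: y; x]>>%VS.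
have dA : \dim A = 2 by apply/eqP; exact: fxy.
have cardE : #|{: {ffun F * F * F -> 'I_r}}| = (r ^ (q * q * q))%N.
  by rewrite card_ffun card_ord !card_prod qF.
(* The colour of [z] records the weights of all vectors in the span of [y], [x] and [z] at once,
   whence q^3 entries. *)
pose chi z := cast_ord cardE (enum_rank
  [ffun p : F * F * F => col (p.1.1 *: y + p.1.2 *: x + p.2 *: z)]).
have [|c [vs [svs fvs vsA lm]]] := HN F V (A^C)%VS qF _ chi.
  by rewrite dimv_compl dA; lia.
have vsAs := seq_in_span vsA.
have capA z : z \in A -> z \in <<vs>>%VS -> z = 0.
  move=> zA /(subvP vsAs) zAC; apply/eqP.
  by rewrite -memv0 -(capv_compl A) memv_cap zA.
have fxyvs : free ([:: y; x] ++ vs).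
  rewrite cat_free fxy fvs /=; apply/directv_addP/eqP.
  by rewrite -subv0; apply/subvP => z /memv_capP[zA zvs]; rewrite memv0 (capA z).
have nz z a b l : z \in <<vs>>%VS -> z != 0 -> l != 0 ->
    a *: y + b *: x + l *: z != 0.
  move=> zvs z0 l0; apply: contra z0 => /eqP E; apply/eqP/capA => //.
  rewrite -(scale_memv _ _ l0) -[l *: z](addKr (a *: y + b *: x)) E addr0.
  by rewrite memvN memvD // memvZ // memv_span // !inE eqxx ?orbT.
have chiE z z' a b l : z \in <<vs>>%VS -> z' \in <<vs>>%VS -> z != 0 -> z' != 0 ->
    l != 0 -> chi z = chi z' -> w (a *: y + b *: x + l *: z) = w (a *: y + b *: x + l *: z').
  move=> zvs z'vs z0 z'0 l0 /cast_ord_inj/enum_rank_inj/ffunP/(_ (a, b, l)).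
  by rewrite !ffunE /=; apply: colE; apply: nz.
have [v0 v0vs [v00 cE]] : exists2 v0, v0 \in <<vs>>%VS & v0 != 0 /\ chi v0 = c.
  case: vs svs fvs lm {vsA vsAs capA fxyvs nz chiE} => // v vs _ fv [/(_ 0 (mem0v _)) + _].
  rewrite addr0 => cE; exists v; first by rewrite memv_span ?mem_head.
  by split; rewrite // (free_not0 fv) ?mem_head.
exists (w v0), vs; split=> //.
  apply: lead_mono_impl fvs lm _ => z zvs z0 zc.
  have := chiE z v0 0 0 1 zvs v0vs z0 v00 (oner_neq0 _); rewrite zc cE => /(_ erefl).
  by rewrite !scale0r !scale1r !add0r.
move=> e; rewrite span_cons span_seq1 => /memv_lineDP[a [_ [/vlineP[b ->] ->]]].
exists (fun l => w (a *: y + b *: x + l *: v0)) => l l0.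
by apply: lead_mono_impl fvs lm _ => z zvs z0 zc; apply: chiE; rewrite ?zc ?cE.
Qed.

(** * The case of lines *)

Lemma free_pair (F : fieldType) (V : vectType F) (x y : V) :
  free [:: y; x] = (y \notin <[x]>%VS) && (x != 0).
Proof. by rewrite free_cons seq1_free span_seq1. Qed.

Section Lines.
Variables (F : finFieldType) (V : vectType F) (R : realType) (h : V -> R).
Local Notation q := #|F|.
Hypothesis hZ : forall (c : F) v, c != 0 -> h (c *: v) = h v.
Hypothesis h_val : forall v, v != 0 -> zero_one (h v) || zero_one (q%:R^-1 - h v).
Hypothesis h_line : forall x y, free [:: y; x] ->
  zero_one (h x + \sum_l h (y + l *: x)).
Implicit Types (v x y p u : V).

Definition fractional v : bool := ~~ zero_one (h v).

Definition integral_part v : int :=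
  if fractional v then (if h v == q%:R^-1 then 0 else -1)
  else (if h v == 0 then 0 else 1).

Local Notation cls := fractional.
Local Notation eps := integral_part.

Let q2 : (2 <= q)%N. Proof. exact: card_finNzRing_gt1. Qed.

Lemma weight_split v : v != 0 -> h v = (eps v)%:~R + (cls v)%:R * q%:R^-1.
Proof.
move=> /h_val; rewrite /integral_part; case c: (cls v); move: c; rewrite /fractional.
  move=> /negPf -> /= /orP[]/eqP E.
    by rewrite -(subr0_eq E) eqxx add0r mul1r.
  have hv : h v = q%:R^-1 - 1 by move/eqP: E; rewrite subr_eq addrC -subr_eq => /eqP.
  rewrite ifF; first by rewrite mul1r hv addrC.
  by rewrite hv -subr_eq0 addrAC subrr add0r oppr_eq0 oner_eq0.
move=> /negbFE/orP[]/eqP -> _; rewrite mul0r addr0 ?eqxx //.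
by rewrite oner_eq0.
Qed.

Lemma integral_part_range v : -1 <= eps v <= 1.
Proof. by rewrite /integral_part; do ![case: ifP => _]. Qed.

Lemma integral_part_sign v : if cls v then eps v <= 0 else 0 <= eps v.
Proof. by rewrite /integral_part; case: (cls v); case: ifP. Qed.

Definition line_fractional x y : nat := cls x + \sum_l cls (y + l *: x).
Definition line_integral x y : int := eps x + \sum_l eps (y + l *: x).

Lemma pencil_neq0 x y (l : F) : free [:: y; x] -> y + l *: x != 0.
Proof. by move/(free_pencil l); rewrite free_cons span_nil memv0 => /andP[]. Qed.

(** The weight of a line is an integer, so its number of fractional points is a multiple of q; being
    at most q + 1 with q >= 2, it is 0 or q. *)
Lemma line_cases x y : free [:: y; x] ->
  (line_fractional x y = 0%N /\ 0 <= line_integral x y <= 1) \/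
  (line_fractional x y = q /\ -1 <= line_integral x y <= 0).
Proof.
move=> fr; have x0 : x != 0 by move: fr; rewrite free_pair => /andP[].
have q0 : q%:R != 0 :> R by rewrite pnatr_eq0; lia.
have sumE : h x + \sum_l h (y + l *: x) =
   (line_integral x y)%:~R + (line_fractional x y)%:R / q%:R.
  rewrite weight_split // (eq_bigr _ (fun l _ => weight_split (pencil_neq0 l fr))).
  rewrite big_split /= -mulr_suml /line_integral /line_fractional.
  by rewrite rmorphD rmorph_sum natrD natr_sum mulrDl addrACA.
have le : (line_fractional x y <= q.+1)%N.
  rewrite /line_fractional -add1n leq_add ?leq_b1 // -[X in (_ <= X)%N]sum1_card.
  by apply: leq_sum => l _; apply: leq_b1.
have key (a : int) : (line_integral x y)%:~R + (line_fractional x y)%:R / q%:R = a%:~R :> R ->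
    line_integral x y * q%:Z + (line_fractional x y)%:Z = a * q%:Z.
  move=> E; apply/eqP; rewrite -(eqr_int R) rmorphD !rmorphM /= -E.
  by rewrite mulrDl [X in _ == _ + X]divfK.
have [H|H] : line_integral x y * q%:Z + (line_fractional x y)%:Z = 0 * q%:Z \/
  line_integral x y * q%:Z + (line_fractional x y)%:Z = 1 * q%:Z.
- have := h_line fr; rewrite sumE => /orP[]/eqP E; [left|right]; exact: key.
- move: (line_fractional x y) (line_integral x y) #|F| q2 le H => n e Q Q2 le H.
  have : (e = 0 \/ e = -1) by nia.
  by case=> e0; move: H; rewrite e0; lia.
- move: (line_fractional x y) (line_integral x y) #|F| q2 le H => n e Q Q2 le H.
  have : (e = 0 \/ e = 1) by nia.
  by case=> e0; move: H; rewrite e0; lia.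
Qed.

Lemma weight_on_line p v : p != 0 -> v != 0 -> v \in <[p]>%VS -> h v = h p.
Proof.
move=> p0 v0 /vlineP[c vE]; rewrite vE hZ //.
by apply: contraNneq v0 => c0; rewrite vE c0 scale0r.
Qed.

(** Two points of weight 1 would give the line joining them weight at least 2. *)
Lemma integral_case : (forall v, v != 0 -> ~~ cls v) ->
  (forall v, v != 0 -> h v = 0) \/
  exists2 p, p != 0 & forall v, v != 0 -> h v = (v \in <[p]>%VS)%:R.
Proof.
move=> ncls.
have heps v : v != 0 -> h v = (eps v)%:~R.
  by move=> v0; rewrite weight_split // (negPf (ncls v v0)) mul0r addr0.
have eps_ge0 v : v != 0 -> 0 <= eps v.
  by move=> v0; have := integral_part_sign v; rewrite (negPf (ncls v v0)).
have [[p p0 ep]|none] := pselect (exists2 p, p != 0 & eps p = 1); [right|left].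
  exists p => // v v0; case: (boolP (v \in <[p]>%VS)) => vp.
    by rewrite (weight_on_line p0 v0 vp) heps // ep.
  have fr : free [:: v; p] by rewrite free_pair vp.
  have : line_integral p v <= 1 by case: (line_cases fr) => -[_ H]; clear -H; lia.
  rewrite /line_integral (bigD1 0) //= scale0r addr0 ep heps //.
  set S := \sum_(i | _) _; have s0 : 0 <= S.
    by apply: sumr_ge0 => i _; apply/eps_ge0/pencil_neq0.
  by have := eps_ge0 v v0 => e0 le; have -> : eps v = 0 by clear -s0 e0 le; lia.
move=> v v0; rewrite heps //; have := eps_ge0 v v0; have /andP[_] := integral_part_range v.
move=> e1 e0; have : eps v <> 1 by move=> ev; apply: none; exists v.
by move=> ne; have -> : eps v = 0 by clear -e1 e0 ne; lia.
Qed.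

(** Two integral points leave at most q - 1 fractional ones, hence none. *)
Lemma line_integer x y : free [:: y; x] -> ~~ cls x -> ~~ cls y ->
  forall l, ~~ cls (y + l *: x).
Proof.
move=> fr nx ny l; apply/negP => cl.
have : (0 < line_fractional x y < q)%N.
  rewrite /line_fractional (negPf nx) add0n; apply/andP; split.
    by rewrite (bigD1 l) //= cl.
  rewrite (bigD1 0) //= scale0r addr0 (negPf ny) add0n.
  have : (\sum_(i | i != 0%R) cls (y + i *: x) <= \sum_(i : F | i != 0%R) 1)%N.
    by apply: leq_sum => i _; apply: leq_b1.
  rewrite sum1_card (cardC1 (0 : F)) => /leq_ltn_trans; apply.
  by rewrite prednK // (leq_trans _ q2).
by have [[-> _]|[-> _]] := line_cases fr; rewrite ?ltnn ?andbF.
Qed.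

Definition integer_space : {vspace V} :=
  (\sum_(P : {vspace V} | is_point P && ~~ cls (vpick P)) P)%VS.

Lemma mem_integer_space v : v != 0 -> (v \in integer_space) = ~~ cls v.
Proof.
move=> v0; apply/idP/idP => [/memv_sumP[vs vsP vE]|nv].
  have : (v == 0) || ~~ cls v; last by rewrite (negPf v0).
  rewrite vE; elim/big_ind: _ => [|x y|P PP].
  - by rewrite eqxx.
  - have [->|x0] := eqVneq x 0; first by rewrite add0r => _; case: eqP.
    have [->|y0] := eqVneq y 0; first by rewrite addr0 (negPf x0).
    move=> /= nx ny; have [yx|yx] := boolP (y \in <[x]>%VS); last first.
      have := @line_integer x y _ nx ny 1; rewrite free_pair yx x0 scale1r => /(_ isT).
      by rewrite addrC => ->; rewrite orbT.
    have [->|xy0] := eqVneq (x + y) 0; rewrite //= /fractional (@weight_on_line x) //.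
    by rewrite memvD ?memv_line.
  - have := vsP P PP; move: (vs P) => z zP; have [//|z0 /=] := eqVneq z 0.
    move: PP zP => /andP[/is_pointP[p p0 ->] np] zp.
    rewrite /fractional (@weight_on_line (vpick <[p]>)) //.
      by rewrite vpick0 -dimv_eq0 dim_vline p0.
    have /vlineP[c cE] := memv_pick <[p]>%VS.
    have c0 : c != 0.
      apply: contraTneq (isT : true) => c0; have := vpick0 <[p]>%VS.
      by rewrite cE c0 scale0r eqxx -dimv_eq0 dim_vline p0.
    by rewrite cE line_scale.
have PP : is_point <[v]>%VS && ~~ cls (vpick <[v]>%VS).
  rewrite point_line //=; rewrite /fractional (@weight_on_line v) ?memv_pick //.
  by rewrite vpick0 -dimv_eq0 dim_vline v0.
by rewrite memvE; apply: (sumv_sup <[v]>%VS).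
Qed.

(** Every line through the fractional point [u] has exactly q fractional points, so it meets the
    integral points, and these together with [u] span everything. *)
Lemma integer_space_hyperplane u : u != 0 -> cls u -> is_hyperplane integer_space.
Proof.
move=> u0 cu; set H := integer_space.
have uH : u \notin H by rewrite mem_integer_space // cu.
have full : (H + <[u]>)%VS = fullv.
  apply/eqP; rewrite eqEsubv subvf /=; apply/subvP => y _.
  have [yu|yu] := boolP (y \in <[u]>%VS); first exact: memv_addr.
  have fr : free [:: y; u] by rewrite free_pair yu.
  have [l nl] : exists l, ~~ cls (y + l *: u).
    apply/existsP; apply: contraT => /existsPn all_cls.
    have : line_fractional u y = q.+1.
      rewrite /line_fractional cu (eq_bigr (fun=> 1%N)) ?sum1_card ?add1n // => l _.
      by have := all_cls l; rewrite negbK => ->.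
    by case: (line_cases fr) => -[-> _]; clear; lia.
  rewrite -(addrK (l *: u) y) memvB //; last by rewrite memv_addr // memvZ // memv_line.
  by rewrite memv_addl // mem_integer_space ?pencil_neq0.
have cap : (H :&: <[u]>)%VS = 0%VS.
  apply/eqP; rewrite -subv0; apply/subvP => z /memv_capP[zH /vlineP[c zE]].
  rewrite memv0; apply: contraNT uH => z0; rewrite zE in zH z0.
  by rewrite -(scale_memv _ _ (_ : c != 0)) //; apply: contraNneq z0 => ->; rewrite scale0r.
by rewrite /is_hyperplane -full dimv_disjoint_sum // dim_vline u0 addn1.
Qed.

Hypothesis dimV : (2 < \dim {:V})%N.

(** Integral parts are nonnegative on the hyperplane and nonpositive off it, and sum to between -1
    and 1 on each line, to at most 0 on lines leaving the hyperplane. *)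
Lemma fractional_case u : u != 0 -> cls u -> exists2 H, is_hyperplane H &
  (forall v, v != 0 -> v \in H -> h v = 0) /\
  ((forall v, v \notin H -> h v = q%:R^-1) \/
   exists2 p, p \notin H & forall v, v \notin H -> h v = q%:R^-1 - (v \in <[p]>%VS)%:R).
Proof.
move=> u0 cu; have hypH := integer_space_hyperplane u0 cu.
set H := integer_space in hypH *.
have uH : u \notin H by rewrite mem_integer_space // cu.
have nH v : v \notin H -> v != 0 by apply: contraNneq => ->; rewrite mem0v.
have clsH v : v \notin H -> cls v.
  by move=> vH; have := vH; rewrite mem_integer_space ?nH // negbK.
have eps_out v : v \notin H -> eps v <= 0.
  by move=> /clsH cv; have := integral_part_sign v; rewrite cv.
have eps_in v : v != 0 -> v \in H -> 0 <= eps v.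
  move=> v0; rewrite mem_integer_space // => /negPf nv.
  by have := integral_part_sign v; rewrite nv.
have line_ge x y : free [:: y; x] -> -1 <= line_integral x y <= 1.
  by move=> fr; case: (line_cases fr) => -[_ E]; clear -E; lia.
have line_le0 x y : free [:: y; x] -> y \notin H -> line_integral x y <= 0.
  move=> fr yH; case: (line_cases fr) => -[n0 E]; last by clear -E; lia.
  move: n0; rewrite /line_fractional (bigD1 0) //= scale0r addr0 (clsH y yH).
  by rewrite addnCA.
(* If [p] in [H] had weight 1, every line through [p] leaving [H] would contain a point with
   integral part -1. Two such points are chosen whose joining line meets [H] in [g], off the point
   [p]; then [g] also has integral part at least 1, and the line through [p] and [g] sums to at
   least 2. *)
have eps0 p : p != 0 -> p \in H -> eps p = 0.
  move=> p0 pH; have := eps_in p p0 pH; have /andP[_] := integral_part_range p.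
  have [ep _ _|] := eqVneq (eps p) 1; last by clear; lia.
  have out y l : y \notin H -> forall g, g \in H -> y + l *: g \notin H.
    move=> yH g gH; apply: contra yH => yg.
    by rewrite -(addrK (l *: g) y) memvB // memvZ.
  have step y : y \notin H -> exists l, eps (y + l *: p) = -1.
    move=> yH; have fr : free [:: y; p].
      rewrite free_pair p0 andbT; apply: contra yH; apply: subvP.
      by rewrite -memvE.
    suff /existsP[l /eqP el] : [exists l, eps (y + l *: p) == -1] by exists l.
    apply: contraT => /existsPn nl.
    have := line_le0 p y fr yH; rewrite /line_integral ep big1 //= => l _.
    have := eps_out _ (out y l yH p pH); have /andP[] := integral_part_range (y + l *: p).
    by have := nl l; move: (eps (y + l *: p)) => e; clear; lia.
  have [h0 h0H h0p] : exists2 h0, h0 \in H & h0 \notin <[p]>%VS.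
    apply/subvPn; apply: contraL dimV => /dimvS; rewrite dim_vline p0.
    by move: hypH; rewrite /is_hyperplane => /eqP <-; clear; lia.
  have [l1 e1] := step u uH.
  have uh0 : u + h0 \notin H by have := out u 1 uH h0 h0H; rewrite scale1r.
  have [l2 e2] := step _ uh0.
  pose g := h0 + (l2 - l1) *: p.
  have gH : g \in H by rewrite memvD // memvZ.
  have gp : g \notin <[p]>%VS.
    apply: contra h0p => gp; rewrite -(addrK ((l2 - l1) *: p) h0) memvB //.
    by rewrite memvZ // memv_line.
  have g0 : g != 0 by apply: contraNneq gp => ->; rewrite mem0v.
  have r1H : u + l1 *: p \notin H by apply: out.
  have fr1 : free [:: u + l1 *: p; g].
    rewrite free_pair g0 andbT; apply: contra r1H; apply: subvP.
    by rewrite -memvE.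
  have eg : 1 <= eps g.
    have /andP[+ _] := line_ge _ _ fr1.
    rewrite /line_integral (bigD1 0) //= scale0r addr0 e1 (bigD1 1) ?oner_eq0 //= scale1r.
    have -> : u + l1 *: p + g = u + h0 + l2 *: p.
      by rewrite /g scalerBl addrACA [_ + (_ - _)]addrC subrK.
    rewrite e2; set S := \sum_(i | _) _; have S0 : S <= 0.
      by apply: sumr_le0 => l _; apply/eps_out/out.
    by clear -S0; lia.
  have fr2 : free [:: g; p] by rewrite free_pair gp.
  have /andP[_] := line_ge _ _ fr2.
  rewrite /line_integral (bigD1 0) //= scale0r addr0 ep.
  set S := \sum_(i | _) _; have S0 : 0 <= S.
    by apply: sumr_ge0 => l _; apply: eps_in; rewrite ?pencil_neq0 // memvD // memvZ.
  by clear -S0 eg; lia.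
exists H => //; split.
  move=> v v0 vH; rewrite weight_split // eps0 //.
  by move: vH; rewrite mem_integer_space // => /negPf ->; rewrite mul0r addr0.
have hE v : v \notin H -> h v = (eps v)%:~R + q%:R^-1.
  by move=> vH; rewrite weight_split ?nH // clsH // mul1r.
(* Two points off [H] with integral part -1 would make their line sum to at most -2. *)
have [[p pH ep]|none] := pselect (exists2 p, p \notin H & eps p = -1); [right|left].
  exists p => // v vH; case: (boolP (v \in <[p]>%VS)) => vp.
    by rewrite (weight_on_line (nH _ pH) (nH _ vH) vp) hE // ep addrC.
  have fr : free [:: v; p] by rewrite free_pair vp nH.
  have /andP[] := line_ge _ _ fr.
  rewrite /line_integral (bigD1 0) //= scale0r addr0 ep hE // subr0.
  set S := \sum_(i | _) _; have S0 : S <= 0.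
    apply: sumr_le0 => l _; have [vlH|/eps_out//] := boolP (v + l *: p \in H).
    by rewrite eps0 ?pencil_neq0.
  by have := eps_out v vH => e0 le _; have -> : eps v = 0; [clear -S0 e0 le; lia|rewrite add0r].
move=> v vH; rewrite hE //; have -> : eps v = 0; last by rewrite add0r.
have := eps_out v vH; have /andP[] := integral_part_range v.
have : eps v <> -1 by move=> ev; apply: none; exists v.
by clear; lia.
Qed.

End Lines.

(** * Classification *)

Section Recover.
Variables (F : finFieldType) (V : vectType F) (R : realType).
Variables (w : V -> R) (m : nat).
Local Notation q := #|F|.
Hypothesis m_gt0 : (0 < m)%N.

Let q1 : 1 < q%:R :> R. Proof. by rewrite ltr1n card_finNzRing_gt1. Qed.
Let q0 : 0 < q%:R :> R. Proof. exact: lt_trans q1. Qed.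
Let qV0 : 0 < q%:R^-1 :> R. Proof. by rewrite invr_gt0. Qed.
Let qV1 : q%:R^-1 < 1 :> R. Proof. by rewrite invf_lt1. Qed.

Lemma reduced_weight_val v : normal_weight w m v ->
  zero_one (reduced_weight w m v) || zero_one (q%:R^-1 - reduced_weight w m v).
Proof.
rewrite /reduced_weight; case: ifP => [-> //|nw]; rewrite /normal_weight nw /=.
have -> : q%:R^-1 - (w v + (q%:R^-1 - q%:R ^- m)) = q%:R ^- m - w v by lra.
by move=> ->; rewrite orbT.
Qed.

Lemma weight_of_integral v : normal_weight w m v ->
  zero_one (reduced_weight w m v) -> w v = reduced_weight w m v.
Proof.
rewrite /reduced_weight; case: ifP => [-> //|nw]; rewrite /normal_weight nw /=.
by have := qV0; have := qV1; move=> ? ? /orP[]/eqP E /orP[]/eqP E'; lra.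
Qed.

Lemma weight_of_fractional v (b : bool) : normal_weight w m v ->
  reduced_weight w m v = q%:R^-1 - b%:R -> w v = q%:R ^- m - b%:R.
Proof.
have := qV0; have := qV1; rewrite /reduced_weight => ? ? _.
case: ifP => [/orP[]/eqP ->|nw E]; last by move: E; lra.
all: by case: b => /= E; lra.
Qed.

(** Normal weights become integers after multiplication by q^m. If both were normal, their sum
    1/[m+1] would make [m+1] divide q^m, impossible because [m+1] = [m] + q^m > q^m. *)
Lemma normal_weight_exclusive v : normal_weight w m v ->
  normal_weight (fun v => (gauss q m.+1)%:R^-1 - w v) m v -> False.
Proof.
have qm0 : q%:R ^+ m != 0 :> R by rewrite expf_neq0 // gt_eqF.
have qmE : q%:R ^+ m = (q ^ m)%N%:Z%:~R :> R by rewrite -natrX.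
have int_val (x : R) : zero_one x || zero_one (q%:R ^- m - x) ->
    exists z : int, x * q%:R ^+ m = z%:~R.
  have t1 : q%:R ^- m * q%:R ^+ m = 1 :> R by rewrite mulVf.
  case/orP => /orP[]/eqP E.
  - by exists 0; rewrite E mul0r.
  - by exists (q ^ m)%N; rewrite E mul1r qmE.
  - by exists 1; rewrite -(subr0_eq E) t1.
  - exists (1 - (q ^ m)%N%:Z).
    have -> : x = q%:R ^- m - 1 by move: E; lra.
    by rewrite mulrBl t1 mul1r qmE rmorphB.
move=> /int_val[z1 z1E] /int_val[z2 z2E].
have g0 : (gauss q m.+1)%:R != 0 :> R by rewrite pnatr_eq0 -lt0n gauss_gt0.
have : (q ^ m)%N%:Z = (z1 + z2) * (gauss q m.+1)%:Z.
  apply/eqP; rewrite -(eqr_int R) rmorphM rmorphD /= -z1E -z2E -mulrDl addrC subrK.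
  by rewrite mulrAC mulVf // mul1r qmE.
have : (0 < q ^ m)%N by rewrite expn_gt0 ltnW // card_finNzRing_gt1.
have := gauss_gt0 q m_gt0; rewrite gaussS.
move: (gauss q m) (q ^ m)%N (z1 + z2) => g e z g0' e0 E.
have [zle|zge] : z <= 0 \/ 1 <= z by lia.
  nia.
nia.
Qed.

End Recover.

Section HyperplaneSums.
Variables (F : finFieldType) (V : vectType F) (R : realType).
Local Notation q := #|F|.

Lemma point_indicator_sum (S : {vspace V}) p : p != 0 ->
  \sum_(P : {vspace V} | is_point P && (P <= S)%VS) (P == <[p]>%VS)%:R
  = (p \in S)%:R :> R.
Proof.
move=> p0; rewrite big_mkcond (bigD1 <[p]>%VS) //= eqxx point_line // big1 ?addr0.
  by rewrite -memvE; case: (p \in S).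
by move=> P /negPf ->; case: ifP.
Qed.

(** If S is not inside H, its points off H correspond to the q^m vectors of a translate of S :&:
    H. *)
Lemma off_hyperplane_sum m (H S : {vspace V}) : is_hyperplane H -> \dim S = m.+1 ->
  \sum_(P : {vspace V} | is_point P && (P <= S)%VS)
     (if (P <= H)%VS then 0 else q%:R ^- m) = (~~ (S <= H)%VS)%:R :> R.
Proof.
move=> /eqP hypH dS; case: (boolP (S <= H)%VS) => [SH|nSH] /=.
  by apply: big1 => P /andP[_ PS]; rewrite (subv_trans PS SH).
have /subvPn[v vS vH] := nSH.
pose vs : seq V := vbasis (S :&: H).
have vsE : <<vs>>%VS = (S :&: H)%VS by apply: span_basis; apply: vbasisP.
have fvs : free vs by apply: basis_free (vbasisP _).
have SHf : (S + H)%VS = fullv.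
  apply/eqP; rewrite eqEdim subvf -hypH ltnNge; apply: contra nSH => le.
  have HSH : (H == S + H)%VS by rewrite eqEdim addvSr.
  by rewrite (eqP HSH) addvSl.
have svs : size vs = m.
  rewrite size_tuple; have := dimv_sum_cap S H; rewrite SHf dS -hypH; lia.
have fvvs : free (v :: vs).
  by rewrite free_cons fvs andbT vsE memv_cap (negPf vH) andbF.
have -> : S = <<v :: vs>>%VS.
  apply/eqP; rewrite eq_sym eqEdim (eqP fvvs) /= svs dS leqnn andbT.
  by rewrite span_cons vsE subv_add -memvE vS capvSl.
pose wt P : R := if (P <= H)%VS then 0 else q%:R ^- m.
rewrite (point_sumE wt fvvs) /= (@flat_sum_const _ _ _ _ _ (q%:R ^- m)).
  rewrite svs -(point_sumE wt fvs) big1 ?addr0; last first.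
    by move=> P /andP[_]; rewrite /wt vsE => /subv_trans ->; rewrite ?capvSr.
  by rewrite -[_ ^- m *+ _]mulr_natl natrX divff // expf_neq0 // pnatr_eq0 -lt0n ltnW // card_finNzRing_gt1.
move=> z; rewrite vsE memv_cap => /andP[_ zH].
by rewrite /wt -memvE ifF //; apply/negbTE; apply: contra vH => H'; rewrite -(addrK z v) memvB.
Qed.

End HyperplaneSums.

Section Assembly.
Variables (F : finFieldType) (V : vectType F) (R : realType) (m : nat).
Local Notation q := #|F|.
Local Notation a := ((gauss q m.+1)%:R^-1 : R).
Hypothesis m_gt0 : (0 < m)%N.
Hypothesis dimV : (2 < \dim {:V})%N.
Implicit Types (Y : {set {vspace V}}) (wt : {vspace V} -> R).

Definition weighting Y wt : Prop := forall S, S \in subspaces V m.+1 ->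
  \sum_(P : {vspace V} | is_point P && (P <= S)%VS) wt P = (S \in Y)%:R.

Definition weight_on_vectors wt v := wt <[v]>%VS.

Lemma span_subspaces (vs : seq V) : free vs -> size vs = m.+1 ->
  <<vs>>%VS \in subspaces V m.+1.
Proof. by move=> fvs svs; rewrite inE (eqP fvs) svs. Qed.

Lemma weighting_zero_one Y wt : weighting Y wt -> forall vs, free vs ->
  size vs = m.+1 -> zero_one (point_sum (weight_on_vectors wt) vs).
Proof.
move=> wtY vs fvs svs; rewrite -(point_sumE wt fvs) wtY ?span_subspaces //.
by case: (_ \in Y); rewrite /zero_one eqxx ?orbT.
Qed.

(** The constant weight 1/[k] sums to 1 on every k-space. *)
Lemma weighting_compl Y wt : weighting Y wt ->
  weighting (subspaces V m.+1 :\: Y) (fun P => a - wt P).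
Proof.
move=> wtY S Sk; rewrite sumrB wtY // inE Sk andbT.
have dS : \dim S = m.+1 by move: Sk; rewrite inE => /eqP.
have -> : \sum_(P : {vspace V} | is_point P && (P <= S)%VS) a = 1.
  have := basis_free (vbasisP S); have := span_basis (vbasisP S).
  have : size (vbasis S) = m.+1 by rewrite size_tuple.
  move: (vbasis S : seq V) => vs svs {1}<- fvs.
  rewrite (point_sumE (fun=> a) fvs) (@point_sum_lead _ _ _ _ a).
    by rewrite svs divff // pnatr_eq0 -lt0n gauss_gt0.
  by elim: (vs) => //= v vs' IH; split.
by case: (S \in Y); rewrite ?subrr ?subr0.
Qed.

Definition regular_pair (w : V -> R) x y : Prop :=
  (forall e, e \in <<[:: y; x]>>%VS -> e != 0 -> normal_weight w m e) /\
  zero_one (reduced_weight w m x + \sum_l reduced_weight w m (y + l *: x)).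

Lemma trivial_of_regular Y wt : Y \subset subspaces V m.+1 -> weighting Y wt ->
  (forall x y, free [:: y; x] -> regular_pair (weight_on_vectors wt) x y) ->
  trivial_family m.+1 Y.
Proof.
move=> Yk wtY reg; pose w := weight_on_vectors wt; pose h := reduced_weight w m.
have normal v : v != 0 -> normal_weight w m v.
  move=> v0; have [y _ fyv] : exists2 y, y \in {:V}%VS & free [:: y; v].
    have dim1 : (1 < \dim {:V})%N := ltnW dimV.
    apply: free_extend1; [by rewrite seq1_free | by move=> x _; apply: memvf | exact: dim1].
  by have [+ _] := reg _ _ fyv; apply; rewrite // memv_span // !inE eqxx orbT.
have hZ (c : F) v : c != 0 -> h (c *: v) = h v.
  by move=> c0; rewrite /h /reduced_weight /w /weight_on_vectors line_scale.
have h_val v : v != 0 -> zero_one (h v) || zero_one (q%:R^-1 - h v).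
  by move=> v0; apply/reduced_weight_val/normal.
have h_line x y : free [:: y; x] -> zero_one (h x + \sum_l h (y + l *: x)).
  by move=> fxy; have [_] := reg _ _ fxy.
have point_mem (p v : V) : p != 0 -> v != 0 -> (v \in <[p]>%VS) = (<[v]>%VS == <[p]>%VS).
  move=> p0 v0; apply/idP/eqP => [vp|<-]; last exact: memv_line.
  by apply: point_le_line; rewrite ?point_line // -memvE.
have bool_inj (b c : bool) : b%:R = c%:R :> R -> b = c.
  by move/eqP; rewrite eqr_nat; case: b c => [] [].
have sumY f : (forall p, p != 0 -> w p = f <[p]>%VS) -> forall S, S \in subspaces V m.+1 ->
    (S \in Y)%:R = \sum_(P : {vspace V} | is_point P && (P <= S)%VS) f P :> R.
  move=> wf S Sk; rewrite -wtY //; apply: eq_bigr => P /andP[/is_pointP[p p0 ->] _].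
  exact: wf.
have setY (Z : {set {vspace V}}) : (forall S, S \in subspaces V m.+1 -> (S \in Y) = (S \in Z)) ->
    Z \subset subspaces V m.+1 -> Y = Z.
  move=> YZ Zk; apply/setP => S; have [/YZ//|Sk] := boolP (S \in subspaces V m.+1).
  by rewrite (contraNF (subsetP Yk S) Sk) (contraNF (subsetP Zk S) Sk).
have [[u u0 cu]|ncls] := pselect (exists2 u, u != 0 & fractional h u).
  have [H hypH [hH hout]] := fractional_case hZ h_val h_line dimV u0 cu.
  have wH v : v != 0 -> v \in H -> w v = 0.
    move=> v0 vH; rewrite (weight_of_integral (normal v v0)) -/(h v) hH //.
    by rewrite /zero_one eqxx.
  have nH v : v \notin H -> v != 0 by apply: contraNneq => ->; rewrite mem0v.
  right; case: hout => [out|[p pH out]].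
    exists (costar m.+1 H); first exact: BasicCostar hypH _.
    apply: setY; last exact: subsetDl.
    move=> S Sk; rewrite inE Sk andbT inE Sk /=; apply: bool_inj.
    have dS : \dim S = m.+1 by move: Sk; rewrite inE => /eqP.
    rewrite -(off_hyperplane_sum R hypH dS); apply: sumY => // v v0.
    rewrite -memvE; case: ifPn => vH; first exact: wH.
    by have := weight_of_fractional (b := false) (normal v v0); rewrite !subr0; apply; exact: out.
  have p0 := nH p pH.
  exists (star m.+1 <[p]>%VS :|: costar m.+1 H).
    by apply: (BasicUnion (P := <[p]>%VS) (H := H)); rewrite ?point_line // -memvE.
  apply: setY; last exact: subsetDl.
  move=> S Sk; rewrite inE Sk andbT inE !inE -!memvE.
  have dS : \dim S = m.+1 by move: Sk; rewrite inE => /eqP.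
  rewrite dS eqxx /=.
  have := sumY (fun P => (if (P <= H)%VS then 0 else q%:R ^- m) - (P == <[p]>%VS)%:R) _ S Sk.
  rewrite sumrB off_hyperplane_sum // point_indicator_sum // => E.
  have {E} : (S \in Y)%:R = (~~ (S <= H)%VS)%:R - (p \in S)%:R :> R.
    apply: E => v v0; rewrite -memvE -point_mem //; case: ifPn => vH.
      rewrite wH // (_ : v \in <[p]>%VS = false) ?subr0 //.
      apply: contraNF pH => /vlineP[c vE]; rewrite vE in vH v0.
      by rewrite -(scale_memv _ _ (_ : c != 0)) //; apply: contraNneq v0 => ->; rewrite scale0r.
    exact: weight_of_fractional (normal v v0) (out v vH).
  have : ~~ ((p \in S) && (S <= H)%VS).
    by apply: contra pH => /andP[pS /subvP]; apply.
  by case: (p \in S) (S <= H)%VS (S \in Y) => [] [] [] //= _ /eqP;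
    rewrite ?subrr ?subr0 ?oner_eq0 // eq_sym oner_eq0.
have intg v : v != 0 -> ~~ fractional h v.
  by move=> v0; apply/negP => cv; apply: ncls; exists v.
have wh v : v != 0 -> w v = h v.
  by move=> v0; rewrite (weight_of_integral (normal v v0)) //; have := intg v v0; rewrite negbK.
left; have [h0|[p p0 hp]] := integral_case hZ h_val h_line intg.
  apply: BasicEmpty; apply: setY; last exact: sub0set.
  move=> S Sk; rewrite inE; apply: bool_inj.
  by rewrite (sumY (fun=> 0)) ?big1 // => v v0; rewrite wh // h0.
apply: (BasicStar (P := <[p]>%VS)); first exact: point_line.
apply: setY; last by apply/subsetP => S; rewrite inE => /andP[].
move=> S Sk; rewrite inE Sk /= -memvE; apply: bool_inj.
rewrite -(point_indicator_sum R _ p0); apply: sumY => // v v0.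
by rewrite wh // hp // point_mem.
Qed.

Definition flip (w : V -> R) : V -> R := fun v => a - w v.

(** The k-space T has weight [k] [c0], so [c0] is 0 or 1/[k]; in the second case flipping makes it
    0. *)
Lemma regular_or_flip Y wt x y (c0 : R) vs (w := weight_on_vectors wt) :
    weighting Y wt -> free ([:: y; x] ++ vs) -> size vs = m.+1 ->
    lead_mono w c0 vs ->
    (forall e, e \in <<[:: y; x]>>%VS -> exists c, transversal_mono w c e vs) ->
  regular_pair w x y \/ regular_pair (flip w) x y.
Proof.
move=> wtY fr svs lm tm.
have fvs := catr_free fr.
have g0 : (gauss q m.+1)%:R != 0 :> R by rewrite pnatr_eq0 -lt0n gauss_gt0.
have := weighting_zero_one wtY fvs svs; rewrite (point_sum_lead lm) svs.
case/orP => [c0E|/eqP c0E]; [left|right].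
  move: c0E; rewrite mulf_eq0 (negPf g0) /= => /eqP c00; rewrite c00 in lm.
  exact: (line_structure m_gt0 (weighting_zero_one wtY) fr svs lm tm).
have c0a : c0 = a by rewrite -(mulKf g0 c0) c0E mulr1.
apply: (line_structure m_gt0 (weighting_zero_one (weighting_compl wtY)) fr svs).
  apply: lead_mono_impl fvs lm _ => z _ _ zc.
  by rewrite /weight_on_vectors -/(weight_on_vectors wt z) -/w zc c0a subrr.
move=> e exy; have [c tmc] := tm e exy; exists (fun l => a - c l) => l l0.
apply: lead_mono_impl fvs (tmc l l0) _ => z _ _ zc.
by rewrite /weight_on_vectors -/(weight_on_vectors wt _) -/w zc.
Qed.

(* A vector normal for both [w] and its flip does not exist, so the two       *)
(* alternatives cannot be mixed.                                              *)
Lemma regular_uniform (w : V -> R) :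
    (forall x y, free [:: y; x] -> regular_pair w x y \/ regular_pair (flip w) x y) ->
  (forall x y, free [:: y; x] -> regular_pair w x y) \/
  (forall x y, free [:: y; x] -> regular_pair (flip w) x y).
Proof.
move=> reg.
have xin (x y : V) : x \in <<[:: y; x]>>%VS by rewrite memv_span // !inE eqxx orbT.
have yin (x y : V) : y \in <<[:: y; x]>>%VS by rewrite memv_span // inE eqxx.
have excl v := @normal_weight_exclusive _ _ _ w m m_gt0 v.
have x0 (x y : V) : free [:: y; x] -> x != 0 by rewrite free_pair => /andP[].
have [[e0 e00 ne0]|all_normal] := pselect (exists2 e, e != 0 & ~~ normal_weight w m e);
    [right|left]; last first.
  move=> x y fxy; have [//|[nf _]] := reg x y fxy.
  have nx : normal_weight w m x.
    by apply/negPn/negP => nx; apply: all_normal; exists x => //; apply: x0 fxy.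
  by case: (excl x nx (nf _ (xin _ _) (x0 _ _ fxy))).
have flip0 y : free [:: y; e0] -> regular_pair (flip w) e0 y.
  move=> fy; have [[nw _]|//] := reg e0 y fy.
  by rewrite nw ?xin in ne0.
(* Every point lies on a line through [e0], and all those lines are regular for the flip. *)
have normal_flip x : x != 0 -> normal_weight (flip w) m x.
  move=> xn0; case: (boolP (x \in <[e0]>%VS)) => xe; last first.
    have fx : free [:: x; e0] by rewrite free_pair xe.
    by have [nf _] := flip0 x fx; apply: nf; rewrite ?yin.
  have [y _ fy] : exists2 y, y \in {:V}%VS & free [:: y; e0].
    have dim1 : (1 < \dim {:V})%N := ltnW dimV.
    apply: free_extend1; [by rewrite seq1_free | by move=> z _; apply: memvf | exact: dim1].
  have [nf _] := flip0 y fy; apply: nf => //.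
  by apply: (subvP _ _ xe); rewrite -memvE xin.
move=> x y fxy; have [[nw _]|//] := reg x y fxy.
by case: (excl x (nw _ (xin _ _) (x0 _ _ fxy)) (normal_flip x (x0 _ _ fxy))).
Qed.

Lemma trivial_family_compl Y : Y \subset subspaces V m.+1 ->
  trivial_family m.+1 (subspaces V m.+1 :\: Y) -> trivial_family m.+1 Y.
Proof.
move=> Yk; have YE : Y = subspaces V m.+1 :\: (subspaces V m.+1 :\: Y).
  by rewrite setDDr setDv set0U; apply/esym/setIidPr.
case=> [b|[Z b E]]; first by right; exists (subspaces V m.+1 :\: Y).
left; rewrite YE E setDDr setDv set0U (setIidPr _) //.
case: b => [->|P _ ->|H _ ->|P H _ _ _ ->]; rewrite ?sub0set ?subUset //.
all: by rewrite ?andbT; do ?[apply/andP; split]; apply/subsetP => S; rewrite inE => /andP[].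
Qed.

End Assembly.

Theorem theorem1 (q k : nat) (q_pp : prime_power q) (k_ge2 : (2 <= k)%N) :
  exists c0 : nat,
    forall (n : nat), (c0 <= maxn k (n - k))%N ->
    forall (R : realType) (F : finFieldType) (V : vectType F),
      #|F| = q -> \dim {:V}%VS = n ->
    forall Y : {set {vspace V}},
      boolean_degree1 R k Y -> trivial_family k Y.
Proof.
case: k k_ge2 => // m m_gt0.
have [N HN] := exists_transversal q m.
(* This bound exceeds k = m + 1, so the hypothesis on the maximum can only hold through n - k, which
   forces n to be large. *)
exists (m + N + 3)%N => n c0n R F V qF dV Y [Yk [wt wtP]].
have [dN d3] : (N <= \dim {:V})%N /\ (2 < \dim {:V})%N.
  by rewrite dV; move: c0n; rewrite leq_max => /orP[]; lia.
have wtY : weighting m Y wt by move=> S Sk; rewrite wtP //; case: (S \in Y).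
have reg x y : free [:: y; x] -> regular_pair m (weight_on_vectors wt) x y \/
    regular_pair m (flip m (weight_on_vectors wt)) x y.
  move=> fxy.
  have [c0 [vs [fr svs lm tm]]] := HN R F V wt qF dN (weighting_zero_one wtY) x y fxy.
  exact: (regular_or_flip m_gt0 wtY fr svs lm tm).
have [r|r] := regular_uniform m_gt0 d3 reg; first exact: (trivial_of_regular d3 Yk wtY r).
apply: trivial_family_compl Yk _.
exact: (trivial_of_regular d3 (subsetDl _ _) (weighting_compl wtY) r).
Qed.
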